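(* (Generic Set Lemma.) Let $G$ be a piecewise hyperdefinable group and $V\subseteq G$ a symmetric generic set. Then, for each $n\in\mathbb{N}$, $V^{n+2}$ is a neighbourhood of $V^n$ in some logic topology of $G$ (i.e. in the $A$-logic topology for some small set of parameters $A$). In particular, if $G$ has a generic piece, then $G$ is locally hyperdefinable. Furthermore, when $G$ is small, $G$ is locally hyperdefinable if and only if it has a generic piece.
   Context: Fix a first-order many-sorted language $\mathcal{L}$ and a $\kappa$-saturated, strongly $\kappa$-homogeneous $\mathcal{L}$-structure $\mathfrak{M}$, with $\kappa>|\mathcal{L}|$ a strong limit cardinal; ''small'' means of cardinality $<\kappa$. A hyperdefinable set is a quotient $P=X/E$ of a nonempty type-definable set $X$ by a type-definable equivalence relation $E$ (over small parameter sets); its elements are hyperimaginaries. Parameter sets $A$ are small sets of hyperimaginaries; $\mathrm{Aut}(\mathfrak{M}/A)$ is the group of automorphisms fixing each element of $A$. $P$ is $A$-hyperdefinable if $X$ and $E$ are $\mathrm{Aut}(\mathfrak{M}/A)$-invariant; a subset of $P$ is $\bigwedge_A$-definable if its preimage in $X$ is type-definable and $\mathrm{Aut}(\mathfrak{M}/A)$-invariant. A piecewise $A$-hyperdefinable set is a direct limit $P=\varinjlim_{i\in I}P_i$ of a directed system of $A$-hyperdefinable sets with injective $\bigwedge_A$-definable transition maps, with $\mathrm{cf}(I)<\kappa$; the $P_i$ (identified with their images) are the pieces. A subset $V\subseteq P$ is piecewise $\bigwedge_A$-definable if $V\cap P_i$ is $\bigwedge_A$-definable for every $i$, and $\bigwedge_A$-definable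 if moreover it is contained in some piece; ''$\bigwedge$-definable'' means $\bigwedge_B$-definable for some small $B$. Products are $\varinjlim_{(i,j)} P_i\times Q_j$. The $A$-logic topology on $P$ has as closed sets exactly the piecewise $\bigwedge_A$-definable sets. $P$ is locally $A$-hyperdefinable if every point has an $\bigwedge_A$-definable neighbourhood in the $A$-logic topology, and locally hyperdefinable if it is locally $A$-hyperdefinable for some small $A$. A piecewise (A-)hyperdefinable group is a group whose universe is a piecewise $A$-hyperdefinable set and whose group operations are piecewise bounded (each piece is mapped into some piece) with piecewise $\bigwedge_A$-definable graphs. A subset $V$ is symmetric if $1\in V=V^{-1}$; $V^n$ is the set of $n$-fold products. An $\bigwedge$-definable $V\subseteq G$ is generic if for every $\bigwedge$-definable $W\subseteq G$ there is a finite $\Delta\subseteq G$ with $W\subseteq \Delta V$; a generic piece is a piece which is generic. *)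

(* Defs.v *)
From mathcomp Require Import all_boot.
From mathcomp Require Import all_classical.

Set Implicit Arguments.
Unset Strict Implicit.
Unset Printing Implicit Defensive.

Local Open Scope classical_set_scope.
Local Open Scope card_scope.

Record language := Language {
  lsort : Type;
  fsym : Type;
  fdom : fsym -> seq lsort;
  fcod : fsym -> lsort;
  rsym : Type;
  rdom : rsym -> seq lsort }.

(* [var G s]: the positions of sort [s] in the context [G] (de Bruijn). *)
Inductive var (S : Type) : seq S -> S -> Type :=
| var0 s G : var (s :: G) s
| varS t G s : var G s -> var (t :: G) s.

Inductive term (L : language) (G : seq (lsort L)) : lsort L -> Type :=
| tvar s : var G s -> term G s
| tapp (f : fsym L) : (forall s, var (fdom f) s -> term G s) -> term G (fcod f).

Inductive formula (L : language) (G : seq (lsort L)) : Type :=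
| fbot
| feq (s : lsort L) (t u : term G s)
| frel (r : rsym L) (t : forall s, var (rdom r) s -> term G s)
| fimp (p q : formula G)
| fall (s : lsort L) (p : formula (s :: G)).

Definition tup (S : Type) (J M : S -> Type) := forall s, J s -> M s.

Definition act (S : Type) (J M : S -> Type) (f : forall s, M s -> M s)
    (a : tup J M) : tup J M := fun s j => f s (a s j).

Record structure (L : language) := Structure {
  carrier :> lsort L -> Type;
  fint (f : fsym L) : tup (var (fdom f)) carrier -> carrier (fcod f);
  rint (r : rsym L) : set (tup (var (rdom r)) carrier) }.

Definition ext (S : Type) (M : S -> Type) (G : seq S) (t : S) (m : M t)
    (e : tup (var G) M) : tup (var (t :: G)) M :=
  fun s v =>
    match v in var D s' return
      match D with
      | [::] => unit
      | t' :: G' => M t' -> tup (var G') M -> M s'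
      end with
    | var0 _ _ => fun m _ => m
    | varS _ _ _ w => fun _ e => e _ w
    end m e.

Fixpoint teval (L : language) (M : structure L) (G : seq (lsort L))
    (e : tup (var G) M) (s : lsort L) (t : term G s) : M s :=
  match t with
  | tvar _ v => e _ v
  | tapp f a => fint (fun s v => teval e (a s v))
  end.

Fixpoint sat (L : language) (M : structure L) (G : seq (lsort L))
    (p : formula G) : tup (var G) M -> Prop :=
  match p with
  | fbot => fun _ => False
  | feq _ t u => fun e => teval e t = teval e u
  | frel _ t => fun e => rint (fun s v => teval e (t s v))
  | fimp p q => fun e => sat p e -> sat q e
  | fall s p => fun e => forall m : M s, sat p (ext m e)
  end.

(* Cardinals: [small K A] means |A| < |K|; the cardinal kappa is represented
   by an arbitrary type [K] of that cardinality. *)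

Definition small (K T : Type) (A : set T) : Prop :=
  A #<= [set: K] /\ ~ ([set: K] #<= A).

Definition strong_limit (K : Type) : Prop :=
  forall X : set K, small K X -> small K [set Y | Y `<=` X].

(* Formulas with parameters, in the variables [J]: each free variable of a
   formula is replaced either by a variable of [J] or by a parameter. *)
Record pformula (L : language) (M : structure L) (J : lsort L -> Type) :=
  PFormula {
    pctx : seq (lsort L);
    pbody : formula pctx;
    pargs : forall s, var pctx s -> J s + M s }.

Definition pover (L : language) (M : structure L) (J : lsort L -> Type)
    (C : forall s, set (M s)) (p : pformula M J) : Prop :=
  forall s (v : var (pctx p) s) m, pargs v = inr m -> C s m.

Definition psat (L : language) (M : structure L) (J : lsort L -> Type)
    (a : tup J M) (p : pformula M J) : Prop :=
  sat (pbody p) (fun s v => match pargs v with inl j => a s j | inr m => m end).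

Definition small_params (K : Type) (L : language) (M : structure L)
    (C : forall s, set (M s)) : Prop :=
  small K [set x : {s : lsort L & M s} | C (projT1 x) (projT2 x)].

Definition saturated (K : Type) (L : language) (M : structure L) : Prop :=
  forall (C : forall s, set (M s)) (s : lsort L)
      (Phi : set (pformula M (var [:: s]))),
    small_params K C -> Phi `<=` pover C ->
    (forall F, finite_set F -> F `<=` Phi -> exists a, F `<=` psat a) ->
    exists a, Phi `<=` psat a.

Definition automorphism (L : language) (M : structure L)
    (f : forall s, M s -> M s) : Prop :=
  [/\ forall s, bijective (f s),
      forall g a, f _ (fint (f := g) a) = fint (act f a)
    & forall r a, rint (r := r) (act f a) <-> rint a].

(* [f] is only relevant on [C]. *)
Definition partial_elementary (L : language) (M : structure L)
    (C : forall s, set (M s)) (f : forall s, M s -> M s) : Prop :=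
  forall (G : seq (lsort L)) (p : formula G) (a : tup (var G) M),
    (forall s v, C s (a s v)) -> (sat p (act f a) <-> sat p a).

Definition strongly_homogeneous (K : Type) (L : language) (M : structure L) :
    Prop :=
  forall (C : forall s, set (M s)) (f : forall s, M s -> M s),
    small_params K C -> partial_elementary C f ->
    exists2 g, automorphism g & forall s x, C s x -> g s x = f s x.

Definition type_definable (K : Type) (L : language) (M : structure L)
    (J : lsort L -> Type) (X : set (tup J M)) : Prop :=
  exists (C : forall s, set (M s)) (Phi : set (pformula M J)),
    [/\ small_params K C, Phi `<=` pover C
      & X = [set a | Phi `<=` psat a]].

Definition sumv (S : Type) (J1 J2 : S -> Type) : S -> Type :=
  fun s => (J1 s + J2 s)%type.

Definition tupl (S : Type) (J1 J2 M : S -> Type) (c : tup (sumv J1 J2) M) :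
  tup J1 M := fun s j => c s (inl j).

Definition tupr (S : Type) (J1 J2 M : S -> Type) (c : tup (sumv J1 J2) M) :
  tup J2 M := fun s j => c s (inr j).

(* Variables may be infinitely many, but form a small set. *)
Record hyperdef (K : Type) (L : language) (M : structure L) := Hyperdef {
  hvars : lsort L -> Type;
  hvars_small : small K [set: {s : lsort L & hvars s}];
  hset : set (tup hvars M);
  hrel : tup hvars M -> tup hvars M -> Prop;
  hset_nonempty : hset !=set0;
  hset_type_definable : type_definable K hset;
  hrel_type_definable :
    type_definable K
      [set c : tup (sumv hvars hvars) M | hrel (tupl c) (tupr c)];
  hrel_sub : forall a b, hrel a b -> hset a /\ hset b;
  hrel_refl : forall a, hset a -> hrel a a;
  hrel_sym : forall a b, hrel a b -> hrel b a;
  hrel_trans : forall a b c, hrel a b -> hrel b c -> hrel a c }.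

Arguments hset {K L M} h.
Arguments hrel {K L M} h _ _.

(* The points of the quotient [hset P / hrel P] are the equivalence classes. *)
Definition hpoint (K : Type) (L : language) (M : structure L)
    (P : hyperdef K M) : Type :=
  {x : set (tup (hvars P) M) | exists2 a, hset P a & x = hrel P a}.

Definition hyperimaginary (K : Type) (L : language) (M : structure L) : Type :=
  {P : hyperdef K M & hpoint P}.

Definition fixes (K : Type) (L : language) (M : structure L)
    (f : forall s, M s -> M s) (x : hyperimaginary K M) : Prop :=
  act f @` sval (projT2 x) = sval (projT2 x).

Definition aut_over (K : Type) (L : language) (M : structure L)
    (A : set (hyperimaginary K M)) : set (forall s, M s -> M s) :=
  [set f | automorphism f /\ A `<=` fixes f].

Definition invariant (K : Type) (L : language) (M : structure L)
    (A : set (hyperimaginary K M)) (J : lsort L -> Type) (X : set (tup J M)) :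
    Prop :=
  forall f, aut_over A f -> forall a, X (act f a) <-> X a.

Definition hyperdefinable (K : Type) (L : language) (M : structure L)
    (A : set (hyperimaginary K M)) (P : hyperdef K M) : Prop :=
  invariant A (hset P) /\
  invariant A [set c : tup (sumv (hvars P) (hvars P)) M |
                hrel P (tupl c) (tupr c)].

(* [wdef] abbreviates "/\-definable".  A subset of P, P x Q or P x Q x R is
   /\_A-definable when its preimage among the tuples of representatives is
   type-definable and Aut(M/A)-invariant; a tuple represents the point [x] when
   it belongs to the class [sval x]. *)

Definition type_definable_over (K : Type) (L : language) (M : structure L)
    (A : set (hyperimaginary K M)) (J : lsort L -> Type) (X : set (tup J M)) :
    Prop :=
  type_definable K X /\ invariant A X.

Definition wdef1 (K : Type) (L : language) (M : structure L)
    (A : set (hyperimaginary K M)) (P : hyperdef K M) (V : set (hpoint P)) :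
    Prop :=
  type_definable_over A [set a | exists2 x, V x & sval x a].

Definition wdef2 (K : Type) (L : language) (M : structure L)
    (A : set (hyperimaginary K M)) (P Q : hyperdef K M)
    (V : hpoint P -> hpoint Q -> Prop) : Prop :=
  type_definable_over A
    [set c : tup (sumv (hvars P) (hvars Q)) M |
      exists x y, [/\ V x y, sval x (tupl c) & sval y (tupr c)]].

Definition wdef3 (K : Type) (L : language) (M : structure L)
    (A : set (hyperimaginary K M)) (P Q R : hyperdef K M)
    (V : hpoint P -> hpoint Q -> hpoint R -> Prop) : Prop :=
  type_definable_over A
    [set c : tup (sumv (sumv (hvars P) (hvars Q)) (hvars R)) M |
      exists x y z, [/\ V x y z, sval x (tupl (tupl c)),
                        sval y (tupr (tupl c)) & sval z (tupr c)]].

(* A presentation of the set [T] as the direct limit of a directed system of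
   hyperdefinable sets with injective transition maps: since the transition
   maps are injective, a cocone [pin] is a direct limit exactly when its maps
   are injective and jointly surjective. *)
Record piecewise (K : Type) (L : language) (M : structure L) (T : Type) :=
  Piecewise {
    idx : Type;
    ple : idx -> idx -> Prop;
    ple_refl : forall i, ple i i;
    ple_trans : forall i j k, ple i j -> ple j k -> ple i k;
    idx_nonempty : inhabited idx;
    idx_directed : forall i j, exists2 k, ple i k & ple j k;
    idx_cofinality : exists2 C : set idx,
      small K C & forall i, exists2 j, C j & ple i j;
    piece : idx -> hyperdef K M;
    trans : forall i j, ple i j -> hpoint (piece i) -> hpoint (piece j);
    trans_inj : forall i j (h : ple i j), injective (trans h);
    trans_id : forall i (h : ple i i) x, trans h x = x;
    trans_comp : forall i j k (hij : ple i j) (hjk : ple j k) (hik : ple i k) x,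
      trans hjk (trans hij x) = trans hik x;
    pin : forall i, hpoint (piece i) -> T;
    pin_trans : forall i j (h : ple i j) x, pin (trans h x) = pin x;
    pin_inj : forall i, injective (pin (i := i));
    pin_surj : forall t, exists i x, pin (i := i) x = t }.

Arguments idx {K L M T} p.
Arguments ple {K L M T} p _ _.
Arguments piece {K L M T} p i.
Arguments trans {K L M T} p {i j} _ _.
Arguments pin {K L M T} p i _.

Definition piecewise_hyperdefinable (K : Type) (L : language)
    (M : structure L) (A : set (hyperimaginary K M)) (T : Type)
    (P : piecewise K M T) : Prop :=
  (forall i, hyperdefinable A (piece P i)) /\
  (forall i j (h : ple P i j), wdef2 A (fun x y => trans P h x = y)).

Definition pieceset (K : Type) (L : language) (M : structure L) (T : Type)
    (P : piecewise K M T) (i : idx P) : set T :=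
  range (pin P i).
Arguments pieceset {K L M T} P i _.

(* Piecewise /\_A-definable subsets *)
Definition pwdef (K : Type) (L : language) (M : structure L)
    (A : set (hyperimaginary K M)) (T : Type) (P : piecewise K M T)
    (V : set T) : Prop :=
  forall i, wdef1 A (pin P i @^-1` V).

Definition wdef_over (K : Type) (L : language) (M : structure L)
    (A : set (hyperimaginary K M)) (T : Type) (P : piecewise K M T)
    (V : set T) : Prop :=
  pwdef A P V /\ exists i : idx P, V `<=` pieceset P i.

Definition wdef (K : Type) (L : language) (M : structure L) (T : Type)
    (P : piecewise K M T) (V : set T) : Prop :=
  exists2 A : set (hyperimaginary K M), small K A & wdef_over A P V.

(* The A-logic topology, whose closed sets are the piecewise /\_A-definable
   sets; they do form a topology when [A] is small and [P] is piecewise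
   A-hyperdefinable. *)

Definition logic_open (K : Type) (L : language) (M : structure L)
    (A : set (hyperimaginary K M)) (T : Type) (P : piecewise K M T)
    (O : set T) : Prop :=
  pwdef A P (~` O).

Definition logic_nbhd (K : Type) (L : language) (M : structure L)
    (A : set (hyperimaginary K M)) (T : Type) (P : piecewise K M T)
    (W U : set T) : Prop :=
  exists2 O, logic_open A P O & W `<=` O /\ O `<=` U.

Definition locally_hyperdefinable_over (K : Type) (L : language)
    (M : structure L) (A : set (hyperimaginary K M)) (T : Type)
    (P : piecewise K M T) : Prop :=
  piecewise_hyperdefinable A P /\
  forall x, exists2 U, wdef_over A P U & logic_nbhd A P [set x] U.

Definition locally_hyperdefinable (K : Type) (L : language)
    (M : structure L) (T : Type) (P : piecewise K M T) : Prop :=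
  exists2 A : set (hyperimaginary K M),
    small K A & locally_hyperdefinable_over A P.

Local Open Scope group_scope.

Definition piecewise_hyperdefinable_group_over (K : Type) (L : language)
    (M : structure L) (A : set (hyperimaginary K M)) (G : groupType)
    (P : piecewise K M G) : Prop :=
  [/\ piecewise_hyperdefinable A P,
      forall i j : idx P, exists k : idx P,
        [set x * y | x in pieceset P i & y in pieceset P j] `<=` pieceset P k,
      forall i : idx P, exists j : idx P,
        [set x^-1 | x in pieceset P i] `<=` pieceset P j,
      forall i j k : idx P, wdef3 A (fun x y z =>
        pin P i x * pin P j y =
        pin P k z)
    & forall i j : idx P, wdef2 A (fun x y =>
        (pin P i x)^-1 = pin P j y)].

Definition piecewise_hyperdefinable_group (K : Type) (L : language)
    (M : structure L) (G : groupType) (P : piecewise K M G) : Prop :=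
  exists2 A : set (hyperimaginary K M),
    small K A & piecewise_hyperdefinable_group_over A P.

Definition symmetric_set (G : groupType) (V : set G) : Prop :=
  V 1 /\ V = [set x^-1 | x in V].

Fixpoint setpow (G : groupType) (V : set G) (n : nat) : set G :=
  match n with
  | 0 => [set 1]
  | n'.+1 => [set x * y | x in setpow V n' & y in V]
  end.

Definition generic (K : Type) (L : language) (M : structure L)
    (G : groupType) (P : piecewise K M G) (V : set G) : Prop :=
  wdef P V /\
  forall W, wdef P W -> exists2 D : set G,
    finite_set D & W `<=` [set x * y | x in D & y in V].

Definition has_generic_piece (K : Type) (L : language) (M : structure L)
    (G : groupType) (P : piecewise K M G) : Prop :=
  exists i : idx P, generic P (pieceset P i).

(* Main.v *)
Require Import Defs.
From mathcomp Require Import all_boot.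
From mathcomp Require Import all_classical.

Set Implicit Arguments.
Unset Strict Implicit.
Unset Printing Implicit Defensive.

Local Open Scope classical_set_scope.

(* Fix a maximal set D such that the translates gV, g in D, are pairwise
   disjoint; by maximality the translates gVV cover G.  By genericity every
   /\-definable set is covered by finitely many translates of V, each of which
   contains at most one point of D, so the cover by the gVV is locally finite
   and D is small.  Hence, over parameters naming the points of D, the union of
   any subfamily of the gVV is closed, and removing those that miss V^n leaves a
   neighbourhood of V^n inside V^(n+4).  As V^(n+4) is covered by finitely many
   translates of V, removing also those that miss V^n gives V^(n+2).  The same
   cover yields local hyperdefinability at every point over one parameter set.
   Conversely, the translates of a neighbourhood of 1 cover each /\-definable
   set, finitely many of them sufficing by compactness when G is small. *)

(** * Small sets *)

Local Open Scope card_scope.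

(** Genericity covers each piece by finitely many translates of [V], but covers chosen piece by
    piece can accumulate: infinitely many translates needed for larger pieces may meet a given
    piece, and the trace of their union there need not be type-definable. Separating the points of
    [D] excludes this. [D] comes from Zorn's lemma and need not be definable; it enters only through
    names for its points, so only its smallness matters. As [K] may be singular, that smallness is
    obtained from finite sets indexed by a small cofinal family of pieces.

    The exponent [n+4] counts factors: if [g VV] meets [V^n], then [g] is reached from a point of
    [V^n] by two factors, and any point of [g VV] by two more. A translate of [V] itself costs one
    factor each way, whence [n+2]. Type-definability of products and inverses requires projecting
    out possibly infinitely many variables, and this is one place where saturation enters. *)

Lemma card_le_rel (T U : Type) (A : set T) (B : set U) (R : T -> U -> Prop) :
    (forall x, A x -> exists2 y, B y & R x y) ->
    (forall x x' y, A x -> A x' -> R x y -> R x' y -> x = x') ->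
  A #<= B.
Proof.
move=> RAB Rinj.
have [f fP] : {f : A -> B & forall x, R (val x) (val (f x))}.
  apply: (@choice _ _ (fun (x : A) (y : B) => R (val x) (val y))) => x.
  have [y By Rxy] := RAB _ (set_valP x).
  by exists (exist _ y (mem_set By)).
apply/asboolP/injfunPex; exists f => // x x' _ _ fxx'.
apply: val_inj; apply: (Rinj _ _ (val (f x))); rewrite ?fxx' //;
  try exact: set_valP.
by rewrite -fxx'.
Qed.

Lemma card_le_fun (T U : Type) (A : set T) (B : set U) : A #<= B ->
  A = set0 \/ exists2 f : T -> U, (forall x, A x -> B (f x)) &
    forall x x', A x -> A x' -> f x = f x' -> x = x'.
Proof.
move=> AB; have [->|/set0P [a Aa]] := eqVneq A set0; first by left.
right; have /asboolP/injfunPex [f _ finj] := AB.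
pose u0 := val (f (exist _ a (mem_set Aa))).
exists (fun x => if pselect (A x) is left Ax
  then val (f (exist _ x (mem_set Ax))) else u0).
  by move=> x Ax; case: pselect => // Ax'; exact: set_valP.
move=> x x' Ax Ax'; case: pselect => // hx; case: pselect => // hx'.
by move=> /val_inj /finj -/(_ (mem_set I) (mem_set I)) [].
Qed.

(** Zorn's lemma yields a maximal partial injection from [A] to [B]; if it missed both a point of
    [A] and a point of [B], that pair could be added. *)
Lemma card_le_total (T U : Type) (A : set T) (B : set U) :
  A #<= B \/ B #<= A.
Proof.
pose P (R : set (T * U)) := [/\ R `<=` A `*` B,
  forall x y y', R (x, y) -> R (x, y') -> y = y' &
  forall x x' y, R (x, y) -> R (x', y) -> x = x'].
have [F FP Ftot|R [[RAB Rf Ri] Rmax]] := @Zorn_bigcup _ P.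
  have Fdir X Y p q : F X -> F Y -> X p -> Y q -> exists Z, [/\ F Z, Z p & Z q].
    move=> FX FY Xp Yq; have [XY|YX] := Ftot _ _ FX FY.
      by exists Y; split=> //; exact: XY.
    by exists X; split=> //; exact: YX.
  split.
  - by move=> p [X FX Xp]; have [+ _ _] := FP _ FX; exact.
  - move=> x y y' [X FX Xp] [Y FY Yq].
    have [Z [FZ Zp Zq]] := Fdir _ _ _ _ FX FY Xp Yq.
    by have [_ + _] := FP _ FZ; apply; eassumption.
  - move=> x x' y [X FX Xp] [Y FY Yq].
    have [Z [FZ Zp Zq]] := Fdir _ _ _ _ FX FY Xp Yq.
    by have [_ _ +] := FP _ FZ; apply; eassumption.
have [domR|/existsNP[a /not_implyP[Aa aR]]] :=
    pselect (forall x, A x -> exists2 y, B y & R (x, y)).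
  left; apply: (card_le_rel (R := fun x y => R (x, y))) => // x x' y _ _.
  exact: Ri.
right; apply: (card_le_rel (R := fun y x => R (x, y))); last first.
  by move=> y y' x _ _; exact: Rf.
move=> b Bb; apply: contrapT => bR.
have aN y : ~ R (a, y).
  by move=> Ray; apply: aR; exists y => //; have [] := RAB _ Ray.
have bN x : ~ R (x, b).
  by move=> Rxb; apply: bR; exists x => //; have [] := RAB _ Rxb.
apply: (Rmax (R `|` [set (a, b)])).
  split; first by move=> p Rp; left.
  by move=> /(_ (a, b)) sub; apply: (aN b); apply: sub; right.
split.
- by move=> p []; [move=> /RAB|move=> ->; split].
- move=> x y y' [Rxy|[xa ->]] [Rxy'|[xa' ->]] //.
  + exact: Rf Rxy Rxy'.
  + by case: (aN y); rewrite -xa'.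
  + by case: (aN y'); rewrite -xa.
- move=> x x' y [Rxy|[-> yb]] [Rxy'|[-> yb']] //.
  + exact: Ri Rxy Rxy'.
  + by case: (bN x); rewrite -yb'.
  + by case: (bN x'); rewrite -yb.
Qed.

Lemma small_le (K T U : Type) (A : set T) (B : set U) :
  A #<= B -> small K B -> small K A.
Proof.
move=> AB [BK KB]; split; first exact: card_le_trans AB BK.
by move=> KA; apply: KB; exact: card_le_trans KA AB.
Qed.

Lemma small_sub (K T : Type) (A B : set T) :
  A `<=` B -> small K B -> small K A.
Proof. by move=> /subset_card_le; exact: small_le. Qed.

Lemma small_image (K T U : Type) (f : T -> U) (A : set T) :
  small K A -> small K (f @` A).
Proof. exact/small_le/card_image_le. Qed.

(** [strong_limit] concerns subsets of [K] only; an injection of [A] into [K] transports its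
    conclusion to any type. *)
Lemma small_powerset (K T : Type) (A : set T) : strong_limit K ->
  small K A -> small K [set Y | Y `<=` A].
Proof.
move=> limK smA; have [A0|[f _ finj]] := card_le_fun (proj1 smA).
  apply: small_le (limK set0 _); last by apply: small_le smA; exact: card_ge0.
  apply: (card_le_rel (R := fun _ _ => True)); first by exists set0.
  move=> X Y _ + + _ _; by rewrite A0 /= !subset0 => -> ->.
apply: small_le (limK (f @` A) (small_image f smA)).
apply: (card_le_rel (R := fun Y Z => Z = f @` Y)).
  by move=> Y YA; exists (f @` Y) => // _ [y Yy <-]; exists y => //; exact: YA.
move=> X Y Z /= XA YA -> XY.
have sub W W' : W `<=` A -> W' `<=` A -> f @` W `<=` f @` W' -> W `<=` W'.
  move=> WA W'A WW' w Ww; have [|w' W'w' ww'] := WW' (f w); first by exists w.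
  by rewrite -(finj w' w) //; [exact: W'A|exact: WA].
by apply/seteqP; split; apply: sub => //; rewrite XY.
Qed.

Lemma small_setX (K T U : Type) (A : set T) (B : set U) : strong_limit K ->
  small K A -> small K B -> small K (A `*` B).
Proof.
move=> limK.
(* Kuratowski pairs embed the square of [C] into its double power set. *)
have sq (V : Type) (C : set V) : A #<= C -> B #<= C -> small K C ->
    small K (A `*` B).
  move=> AC BC smC; have smPPC := small_powerset limK (small_powerset limK smC).
  apply: small_le smPPC.
  have [A0|[f fAC finj]] := card_le_fun AC.
    by rewrite A0 set0X; exact: card_ge0.
  have [B0|[g gBC ginj]] := card_le_fun BC.
    by rewrite B0 setX0; exact: card_ge0.
  apply: (card_le_rel (R := fun p Z =>
    Z = [set [set f p.1]; [set f p.1; g p.2]])).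
    move=> [x y] [/= Ax By]; exists [set [set f x]; [set f x; g y]] => //.
    move=> Y [->|->]; first by move=> z ->; exact: fAC.
    by move=> z [->|->]; [exact: fAC|exact: gBC].
  move=> [x y] [x' y'] Z [/= Ax By] [/= Ax' By'] -> eZ.
  have fx : f x = f x'.
    have : [set [set f x']; [set f x'; g y']] [set f x] by rewrite -eZ; left.
    move=> [|] e; first by have : [set f x'] (f x) by rewrite -e.
    by apply/esym; have : [set f x] (f x') by rewrite e; left.
  have gy : g y = g y'.
    have h1 : [set [set f x']; [set f x'; g y']] [set f x; g y].
      by rewrite -eZ; right.
    have h2 : [set [set f x]; [set f x; g y]] [set f x'; g y'].
      by rewrite eZ; right.
    have gyE : [set f x; g y] (g y) by right.
    have gy'E : [set f x'; g y'] (g y') by right.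
    case: h1 => e.
      move: gyE; rewrite e => gyx; have {}gyx : g y = f x' by [].
      rewrite gyx -fx; case: h2 => e'.
        by have : [set f x] (g y') by rewrite -e'; right.
      by move: gy'E; rewrite e' gyx -fx => -[->|->].
    move: gyE gy'E; rewrite e => -[e1|->//]; rewrite -e => -[e2|->//].
    by rewrite e1 e2 fx.
  by congr (_, _); [exact: finj|exact: ginj].
move=> smA smB; have [AB|BA] := card_le_total A B.
  by apply: (sq _ B) => //; exact: card_lexx.
by apply: (sq _ A) => //; exact: card_lexx.
Qed.

(** The union embeds in the product of the larger set with [nat], the second coordinate telling from
    which set a point is taken. *)
Lemma small_setU (K T : Type) (A B : set T) : strong_limit K ->
  small K [set: nat] -> small K A -> small K B -> small K (A `|` B).
Proof.
move=> limK smN.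
have sm2 (V : Type) (C : set V) : A #<= C -> B #<= C -> small K C ->
    small K (A `|` B).
  move=> AC BC smC; apply: small_le (small_setX limK smC smN).
  have [->|[f fAC finj]] := card_le_fun AC.
    rewrite set0U; have [->|[g gBC ginj]] := card_le_fun BC.
      exact: card_ge0.
    apply: (card_le_rel (R := fun x p => p = (g x, 0))).
      by move=> x Bx; exists (g x, 0) => //; split => //; exact: gBC.
    by move=> x x' _ Bx Bx' -> [] /ginj ->.
  have [->|[g gBC ginj]] := card_le_fun BC.
    rewrite setU0; apply: (card_le_rel (R := fun x p => p = (f x, 0))).
      by move=> x Bx; exists (f x, 0) => //; split => //; exact: fAC.
    by move=> x x' _ Bx Bx' -> [] /finj ->.
  apply: (card_le_rel (R := fun x p =>
    (A x /\ p = (f x, 0)) \/ (B x /\ p = (g x, 1)))).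
    move=> x [Ax|Bx]; first by exists (f x, 0); [split=> //; exact: fAC|left].
    by exists (g x, 1); [split=> //; exact: gBC|right].
  move=> x x' p _ _ [[Ax ->]|[Bx ->]] [[Ax' []]|[Bx' []]] //.
    exact: finj.
  exact: ginj.
move=> smA smB; have [AB|BA] := card_le_total A B.
  by apply: (sm2 _ B) => //; exact: card_lexx.
by apply: (sm2 _ A) => //; exact: card_lexx.
Qed.

Lemma small_finite (K T : Type) (A : set T) :
  small K [set: nat] -> finite_set A -> small K A.
Proof. by move=> smN /finite_set_countable A0; exact: small_le smN. Qed.

(** Numbering each finite set embeds the union in the product of [D] with [nat]. This bound survives
    when [K] is singular, whereas a small union of small sets may then fail to be small. *)
Lemma small_bigcup_finite (K I T : Type) (D : set I) (F : I -> set T) :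
    strong_limit K -> small K [set: nat] -> small K D ->
    (forall i, D i -> finite_set (F i)) ->
  small K (\bigcup_(i in D) F i).
Proof.
move=> limK smN smD Ffin; apply: small_le (small_setX limK smD smN).
have [f fP] : {f : I -> T -> nat & forall i, D i -> forall x x',
    F i x -> F i x' -> f i x = f i x' -> x = x'}.
  apply: (@choice _ _ (fun i (f : T -> nat) => D i -> forall x x',
    F i x -> F i x' -> f x = f x' -> x = x')) => i.
  have [Di|nDi] := pselect (D i); last by exists (fun _ => 0).
  have /countable_injP [f fi] := finite_set_countable (Ffin _ Di).
  by exists f => _ x x' Fx Fx' e; apply: fi; rewrite ?inE.
apply: (card_le_rel (R := fun x p => D p.1 /\ F p.1 x /\ p.2 = f p.1 x)).
  by move=> x [i Di Fx]; exists (i, f i x).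
by move=> x x' [i n] _ _ /= [Di [Fx ->]] [_ [Fx' /(fP _ Di)]]; exact.
Qed.

(** * Definable sets *)

Lemma finite_set_ind (T : Type) (P : set T -> Prop) :
    P set0 -> (forall x A, finite_set A -> P A -> P (x |` A)) ->
  forall A, finite_set A -> P A.
Proof.
move=> P0 PS A /(@finite_seqP {classic T})[s ->]; elim: s => [|x s IH].
  by rewrite set_nil.
have -> : [set` x :: s] = x |` [set` s].
  apply/seteqP; split=> y /=; rewrite in_cons.
    by case/orP => [/eqP|]; [left|right].
  by move=> [->|->]; rewrite ?eqxx ?orbT.
by apply: PS => //; exact: (@finite_seq {classic T}).
Qed.

Lemma finite_subchain (T : Type) (F : set (set T)) (A : set T) :
    total_on F subset -> finite_set A -> A `<=` \bigcup_(X in F) X ->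
  A = set0 \/ exists2 X, F X & A `<=` X.
Proof.
move=> Ftot; move: A; apply: finite_set_ind; first by left.
move=> x A _ IH xA; right.
have [X FX Xx] := xA x (or_introl erefl).
have [A0|[Y FY AY]] := IH (fun y Ay => xA y (or_intror Ay)).
  by exists X => // y [->//|]; rewrite A0.
have [XY|YX] := Ftot _ _ FX FY.
  by exists Y => // y [->|/AY//]; exact: XY.
by exists X => // y [->//|/AY]; exact: YX.
Qed.

Lemma finite_subset_image (T U : Type) (f : T -> U) (A : set T) (B : set U) :
    finite_set B -> B `<=` f @` A ->
  exists F, [/\ finite_set F, F `<=` A & B = f @` F].
Proof.
move: B; apply: finite_set_ind.
  by exists set0; split=> //; rewrite image_set0.
move=> y B _ IH yBA; have [|F [Ffin FA ->]] := IH.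
  by move=> z Bz; apply: yBA; right.
have [x Ax fx] := yBA y (or_introl erefl).
exists (x |` F); split; first by rewrite finite_setU.
  by move=> z [->|/FA].
by rewrite image_setU image_set1 fx.
Qed.

Lemma tup_ext (S : Type) (J M : S -> Type) (a b : tup J M) :
  (forall s j, a s j = b s j) -> a = b.
Proof.
by move=> ab; apply: functional_extensionality_dep => s; apply/funext => j.
Qed.

(** Dependent case analysis on a variable of a nonempty context. The return predicate computes on
    the context, so sorts need not be compared. *)
Lemma var_consP (S : Type) (t : S) (G : seq S)
    (Q : forall s, var (t :: G) s -> Prop) :
  Q t (var0 t G) -> (forall s w, Q s (varS t w)) -> forall s v, Q s v.
Proof.
move=> Q0 QS s v; move: Q Q0 QS.
refine (match v in var D s' return
  match D return var D s' -> Prop with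
  | [::] => fun _ => True
  | t' :: G' => fun v => forall Q : forall s, var (t' :: G') s -> Prop,
      Q t' (var0 t' G') -> (forall s w, Q s (varS t' w)) -> Q s' v
  end v with var0 _ _ => _ | varS _ _ _ _ => _ end).
  by move=> Q Q0 _; exact: Q0.
by move=> Q _ QS; exact: QS.
Qed.

Lemma finite_var (S : Type) (G : seq S) : finite_set [set: {s & var G s}].
Proof.
elim: G => [|t G IH].
  apply: sub_finite_set (finite_set0 _) => -[s v] _; inversion v.
apply: (@sub_finite_set _ _ (existT _ t (var0 t G) |`
    (fun x => existT _ (projT1 x) (varS t (projT2 x))) @` [set: {s & var G s}])).
  move=> [s v] _; move: s v; apply: var_consP; first by left.
  by move=> s w; right; exists (existT _ s w).
by rewrite finite_setU; split; [exact: finite_set1|exact: finite_image].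
Qed.

(** * Renaming and concatenation of contexts *)

Fixpoint tren (L : language) (G G' : seq (lsort L))
    (r : forall s, var G s -> var G' s) s (t : term G s) : term G' s :=
  match t with
  | tvar s v => tvar (r s v)
  | tapp f a => tapp (fun s v => tren r (a s v))
  end.

(** Under a quantifier the renaming keeps the bound variable and shifts the others; [ext] serves
    here with variables as values. *)
Fixpoint fren (L : language) (G : seq (lsort L)) (p : formula G) :
    forall G', (forall s, var G s -> var G' s) -> formula G' :=
  match p with
  | fbot => fun G' r => fbot G'
  | feq _ t u => fun G' r => feq (tren r t) (tren r u)
  | Defs.frel R t => fun G' r => Defs.frel (fun s v => tren r (t s v))
  | fimp p q => fun G' r => fimp (fren p r) (fren q r)
  | fall s p => fun G' r =>
      fall (fren p (ext (M := var (s :: G')) (var0 s G')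
                        (fun t v => varS s (r t v))))
  end.

Lemma teval_ren (L : language) (M : structure L) (G G' : seq (lsort L))
    (r : forall s, var G s -> var G' s) (e : tup (var G') M) s (t : term G s) :
  teval e (tren r t) = teval (fun s v => e s (r s v)) t.
Proof.
elim: t => [//|f a IH] /=; congr fint.
exact: tup_ext.
Qed.

Lemma sat_ren (L : language) (M : structure L) (G G' : seq (lsort L))
    (p : formula G) (r : forall s, var G s -> var G' s) (e : tup (var G') M) :
  sat (fren p r) e <-> sat p (fun s v => e s (r s v)).
Proof.
elim: p G' r e => {G} /= [//|G s t u|G R t|G p IHp q IHq|G s p IH] G' r e.
- by rewrite !teval_ren.
- suff -> : (fun s v => teval e (tren r (t s v))) =
     (fun s v => teval (fun s v => e s (r s v)) (t s v)) by [].
  by apply: tup_ext => s v; exact: teval_ren.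
- by rewrite IHp IHq.
suff extE m : (fun t v => ext m e (ext (M := var (s :: G')) (var0 s G')
      (fun t v => varS s (r t v)) v)) =
    ext m (fun s v => e s (r s v)) :> tup _ M.
  by split=> + m => /(_ m); rewrite IH extE.
by apply: tup_ext => t v; move: t v; apply: var_consP.
Qed.

Fixpoint varL (S : Type) (G G' : seq S) s (v : var G s) : var (G ++ G') s :=
  match v with
  | var0 s G => var0 s (G ++ G')
  | varS t G s w => varS t (varL G' w)
  end.

Fixpoint varR (S : Type) (G G' : seq S) s (v : var G' s) : var (G ++ G') s :=
  if G is t :: G then varS t (varR G v) else v.

Fixpoint env_cat (S : Type) (B : S -> Type) (G G' : seq S) :
    tup (var G) B -> tup (var G') B -> tup (var (G ++ G')) B :=
  match G with
  | [::] => fun f g => g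
  | t :: G => fun f g =>
      ext (f t (var0 t G)) (env_cat (fun s v => f s (varS t v)) g)
  end.

Lemma env_catL (S : Type) (B : S -> Type) (G G' : seq S) (f : tup (var G) B)
  (g : tup (var G') B) s (v : var G s) : env_cat f g (varL G' v) = f s v.
Proof.
by elim: v f => {G s} [s G|t G s w IH] f //=; rewrite IH.
Qed.

Lemma env_catR (S : Type) (B : S -> Type) (G G' : seq S) (f : tup (var G) B)
  (g : tup (var G') B) s (v : var G' s) : env_cat f g (varR G v) = g s v.
Proof. by elim: G f => [//|t G IH] f /=; rewrite IH. Qed.

Lemma env_cat_cases (S : Type) (B : S -> Type) (G G' : seq S)
    (f : tup (var G) B) (g : tup (var G') B) s (v : var (G ++ G') s) :
  (exists w, env_cat f g v = f s w) \/ (exists w, env_cat f g v = g s w).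
Proof.
elim: G f s v => [f s v|t G IH f]; first by right; exists v.
apply: var_consP => [|s w]; first by left; exists (var0 t G).
have [[u /= ->]|[u /= ->]] := IH (fun s v => f s (varS t v)) s w.
  by left; exists (varS t u).
by right; exists u.
Qed.

Definition env_nil (S : Type) (B : S -> Type) : tup (var [::]) B :=
  fun s v =>
    match v in var G t return if G is [::] then B t else unit with
    | var0 _ _ => tt
    | varS _ _ _ _ => tt
    end.

Definition pval (S : Type) (J M : S -> Type) (a : tup J M) s (x : J s + M s) :
    M s :=
  match x with inl j => a s j | inr m => m end.

(** Definability is recorded on sets of tuples over a fixed [C], so that later arguments use closure
    properties instead of syntax. *)
Definition definable (L : language) (M : structure L) (J : lsort L -> Type)
    (C : forall s, set (M s)) (X : set (tup J M)) : Prop :=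
  exists2 p : pformula M J, pover C p & X = [set a | psat a p].

Lemma definable_bot (L : language) (M : structure L) (J : lsort L -> Type)
  (C : forall s, set (M s)) : definable C (set0 : set (tup J M)).
Proof.
by exists (PFormula (fbot [::]) (@env_nil _ _)) => // s v; inversion v.
Qed.

(** The two formulas live in unrelated contexts; both are renamed into the concatenated context,
    whose arguments are [f] on the left part and [g] on the right. *)
Lemma definable_imp (L : language) (M : structure L) (J : lsort L -> Type)
    (C : forall s, set (M s)) (X Y : set (tup J M)) :
  definable C X -> definable C Y -> definable C [set a | X a -> Y a].
Proof.
move=> [[G p f] pC ->] [[G' q g] qC ->].
exists (PFormula (fimp (fren p (@varL _ G G')) (fren q (@varR _ G G')))
         (env_cat (B := fun s => (J s + M s)%type) f g)).
  move=> s v m /=.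
  have [[w ->]|[w ->]] := env_cat_cases (B := fun s => (J s + M s)%type) f g v.
    exact: pC.
  exact: qC.
suff envE a : sat (fren p (@varL _ G G')) (fun s v => pval a (env_cat f g v)) =
    sat p (fun s v => pval a (f s v)) /\ sat (fren q (@varR _ G G'))
    (fun s v => pval a (env_cat (B := fun s => (J s + M s)%type) f g v)) =
    sat q (fun s v => pval a (g s v)).
  by apply/seteqP; split=> a; have [] := envE a; rewrite /psat /= => -> ->.
split; apply/propext; rewrite sat_ren.
  suff -> : (fun s v => pval a (env_cat f g (varL G' v))) =
    (fun s v => pval a (f s v)) by [].
  by apply: tup_ext => s v; rewrite env_catL.
suff -> : (fun s v => pval a (env_cat f g (varR G v))) =
  (fun s v => pval a (g s v)) by [].
by apply: tup_ext => s v; rewrite env_catR.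
Qed.

Lemma definable_not (L : language) (M : structure L) (J : lsort L -> Type)
    (C : forall s, set (M s)) (X : set (tup J M)) :
  definable C X -> definable C (~` X).
Proof. by move=> defX; exact: definable_imp defX (definable_bot _ _). Qed.

Lemma definable_setU (L : language) (M : structure L) (J : lsort L -> Type)
    (C : forall s, set (M s)) (X Y : set (tup J M)) :
  definable C X -> definable C Y -> definable C (X `|` Y).
Proof.
move=> /definable_not defX defY.
suff -> : X `|` Y = [set a | (~` X) a -> Y a] by exact: definable_imp.
apply/seteqP; split=> a /=; first by move=> [].
by have [Xa _|nXa /(_ nXa)] := pselect (X a); [left|right].
Qed.

Lemma definable_setI (L : language) (M : structure L) (J : lsort L -> Type)
    (C : forall s, set (M s)) (X Y : set (tup J M)) :
  definable C X -> definable C Y -> definable C (X `&` Y).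
Proof.
move=> /definable_not defX /definable_not defY.
by rewrite -[_ `&` _]setCK setCI; apply/definable_not/definable_setU.
Qed.

Lemma definable_bigcap (L : language) (M : structure L) (J : lsort L -> Type)
    (C : forall s, set (M s)) (F : set (set (tup J M))) :
    finite_set F -> (forall X, F X -> definable C X) ->
  definable C (\bigcap_(X in F) X).
Proof.
move: F; apply: finite_set_ind => [_|X F _ IH defF].
  by rewrite bigcap_set0 -setC0; exact/definable_not/definable_bot.
rewrite bigcap_setU1; apply: definable_setI; first by apply: defF; left.
by apply: IH => Y FY; apply: defF; right.
Qed.

(** Replacing variables by other variables or by parameters leaves the formula untouched: only its
    arguments change. *)
Lemma definable_subst (L : language) (M : structure L) (J J' : lsort L -> Type)
    (C C' : forall s, set (M s)) (f : forall s, J s -> J' s + M s)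
    (X : set (tup J M)) :
    (forall s, C s `<=` C' s) -> (forall s j m, f s j = inr m -> C' s m) ->
  definable C X -> definable C' [set a | X (fun s j => pval a (f s j))].
Proof.
move=> CC' fC' [[G p g] pC ->].
exists (PFormula p
  (fun s v => match g s v with inl j => f s j | inr m => inr m end)).
  move=> s v m /=; case E: (g s v) => [j|m']; first exact: fC'.
  by move=> [<-]; apply: CC'; exact: pC E.
suff satE a : psat a (PFormula p (fun s v =>
    match g s v with inl j => f s j | inr m => inr m end)) =
    psat (fun s j => pval a (f s j)) (PFormula p g).
  by apply/seteqP; split=> a /=; rewrite satE.
congr (sat p _); apply: tup_ext => s v /=.
by case: (g s v).
Qed.

Lemma definable_mono (L : language) (M : structure L) (J : lsort L -> Type)
    (C C' : forall s, set (M s)) (X : set (tup J M)) :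
  (forall s, C s `<=` C' s) -> definable C X -> definable C' X.
Proof. by move=> CC' [p pC ->]; exists p => // s v m /pC /CC'. Qed.

Definition upd (S : Type) (J M : S -> Type) (a : tup J M) (j : {s & J s})
    (m : M (projT1 j)) : tup J M :=
  fun t k =>
    if pselect (j = existT _ t k) is left e
    then match e in _ = x return M (projT1 x) with erefl => m end
    else a t k.

Lemma upd_eq (S : Type) (J M : S -> Type) (a : tup J M) (j : {s & J s})
  (m : M (projT1 j)) : upd a m (projT2 j) = m.
Proof.
case: j m => s j m; rewrite /upd; case: pselect => // e.
by rewrite (Prop_irrelevance e (erefl _)).
Qed.

Lemma upd_neq (S : Type) (J M : S -> Type) (a : tup J M) (j : {s & J s})
    (m : M (projT1 j)) s (k : J s) :
  j <> existT _ s k -> upd a m k = a s k.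
Proof. by rewrite /upd; case: pselect. Qed.

Definition agree_off (S : Type) (J M : S -> Type) (E : set {s & J s})
    (a b : tup J M) : Prop :=
  forall s j, ~ E (existT _ s j) -> a s j = b s j.

Lemma definable_forall (L : language) (M : structure L) (J : lsort L -> Type)
    (C : forall s, set (M s)) (j : {s & J s}) (X : set (tup J M)) :
  definable C X ->
  definable C [set a | forall b, agree_off [set j] a b -> X b].
Proof.
move=> [[G p g] pC ->].
(* Several positions of the context may carry [j]: all are redirected to the bound variable and the
   others are shifted. The arguments [g] can then be kept, since the positions carrying [j] are no
   longer read. *)
pose r s (v : var G s) : var (projT1 j :: G) s :=
  if g s v is inl k then
    if pselect (j = existT _ s k) is left e
    then match e in _ = x return var (projT1 j :: G) (projT1 x) with
         | erefl => var0 _ _ end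
    else varS _ v
  else varS _ v.
exists (PFormula (fall (fren p r)) g) => //.
suff envE a b : agree_off [set j] a b ->
    (fun s v => ext (b _ (projT2 j)) (fun s v => pval a (g s v)) (r s v)) =
    (fun s v => pval b (g s v)) :> tup (var G) M.
  apply/seteqP; split=> a /=; rewrite /psat /= => h.
    move=> m; pose b := upd a m.
    have ab : agree_off [set j] a b.
      by move=> s k /= jk; rewrite /b upd_neq // => e; apply: jk.
    have bj : b _ (projT2 j) = m by exact: upd_eq.
    have {}h : sat p (fun s v => pval b (g s v)) := h b ab.
    apply: (proj2 (sat_ren p r (ext m (fun s v => pval a (g s v))))).
    by rewrite -bj (envE _ _ ab).
  move=> b ab.
  have := proj1 (sat_ren p r (ext _ (fun s v => pval a (g s v))))
    (h (b _ (projT2 j))).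
  by rewrite (envE _ _ ab).
move=> ab; apply: tup_ext => s v; rewrite /r.
case E: (g s v) => [k|m]; last by rewrite /= E.
case: (pselect (j = existT _ s k)) => [e|jk]; last first.
  rewrite /= E; apply: ab => /= e; exact: jk.
suff ext_cast x (e' : j = x) :
    ext (b _ (projT2 j)) (fun s v => pval a (g s v))
      (match e' in _ = x return var (projT1 j :: G) (projT1 x) with
       | erefl => var0 _ _ end) = b _ (projT2 x) by exact: (ext_cast _ e).
by case: _ / e'.
Qed.

Lemma definable_exists (L : language) (M : structure L) (J : lsort L -> Type)
    (C : forall s, set (M s)) (j : {s & J s}) (X : set (tup J M)) :
  definable C X ->
  definable C [set a | exists2 b, X b & agree_off [set j] a b].
Proof.
move=> /definable_not /(definable_forall j) /definable_not.
congr (definable C _); apply/seteqP; split=> a /=.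
  by move=> /existsNP[b /not_implyP[ab /contrapT Xb]]; exists b.
by move=> [b Xb ab] /(_ b ab).
Qed.

Lemma definable_exists_finite (L : language) (M : structure L)
    (J : lsort L -> Type) (C : forall s, set (M s)) (E : set {s & J s})
    (X : set (tup J M)) :
  finite_set E -> definable C X ->
  definable C [set a | exists2 b, X b & agree_off E a b].
Proof.
move=> Efin; move: E Efin X; apply: finite_set_ind => [X|j E _ IH X].
  congr (definable C _); apply/seteqP; split=> a /=.
    by move=> Xa; exists a.
  by move=> [b Xb ab]; suff -> : a = b by []; apply: tup_ext => s k; exact: ab.
move=> /IH /(definable_exists j).
congr (definable C _); apply/seteqP; split=> a /=.
  move=> [b [c Xc bc] ab]; exists c => // s k nE.
  by rewrite ab ?bc // => h; apply: nE; [right|left].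
move=> [c Xc ac].
pose b := upd a (j := j) (c _ (projT2 j)).
exists b.
  exists c => // s k Ek; rewrite /b.
  have [e|jk] := pselect (j = existT _ s k).
    by subst j; exact: (upd_eq a (j := existT _ s k)).
  by rewrite upd_neq // ac // => -[e|//]; apply: jk.
by move=> s k /= jk; rewrite /b upd_neq // => e; apply: jk.
Qed.

(** The context of a formula is a finite list, so only finitely many variables of [J] are read, even
    when [J] is infinite. *)
Lemma definable_support (L : language) (M : structure L) (J : lsort L -> Type)
    (C : forall s, set (M s)) (X : set (tup J M)) :
  definable C X ->
  exists2 E : set {s & J s}, finite_set E &
    forall a b, (forall s j, E (existT _ s j) -> a s j = b s j) -> X a -> X b.
Proof.
move=> [[G p g] _ ->].
exists (\bigcup_(v in [set: {s & var G s}])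
    [set j : {s & J s} | exists e : projT1 v = projT1 j,
      ecast s (J s + M s)%type e (g _ (projT2 v)) = inl (projT2 j)]).
  apply: bigcup_finite => [|[s v] _]; first exact: finite_var.
  case E : (g s v) => [k|m].
    apply: sub_finite_set (finite_set1 (existT J s k)) => -[t j] [/= e].
    by move: e j; case: t / => j /= -[->].
  apply: sub_finite_set (finite_set0 _) => -[t j] [/= e].
  by move: e j; case: t / => j.
move=> a b ab; rewrite /psat /=.
suff -> : (fun s v => pval a (g s v)) =
  (fun s v => pval b (g s v)) :> tup (var G) M by [].
apply: tup_ext => s v; case E : (g s v) => [k|//] /=.
by apply: ab; exists (existT _ s v) => //=; exists erefl; rewrite /= E.
Qed.

(** * Compactness *)

Lemma saturated_definable (K : Type) (L : language) (M : structure L)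
    (C : forall s, set (M s)) (s : lsort L)
    (F : set (set (tup (var [:: s]) M))) :
    saturated K M -> small_params K C -> (forall X, F X -> definable C X) ->
    (forall F', finite_set F' -> F' `<=` F -> exists a, forall X, F' X -> X a) ->
  exists a, forall X, F X -> X a.
Proof.
move=> satM smC defF fip.
pose Phi := [set p : pformula M (var [:: s]) |
  pover C p /\ F [set a | psat a p]].
have [p []//|F' F'fin F'Phi|a aPhi] := satM C s Phi smC.
  have [||a aF'] := fip ((fun p => [set a | psat a p]) @` F').
  - exact: finite_image.
  - by move=> _ [p /F'Phi[_ Fp] <-].
  by exists a => p F'p; apply: (aF' [set a | psat a p]); exists p.
exists a => X FX; have [p pC XE] := defF _ FX.
by rewrite XE in FX *; apply: aPhi.
Qed.

Lemma small_paramsU (K : Type) (L : language) (M : structure L)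
    (C C' : forall s, set (M s)) : strong_limit K -> small K [set: nat] ->
    small_params K C -> small_params K C' ->
  small_params K (fun s => C s `|` C' s).
Proof.
move=> limK smN smC smC'; apply: small_sub (small_setU limK smN smC smC').
by move=> [s m] [Cm|Cm]; [left|right].
Qed.

Definition trange (S : Type) (J M : S -> Type) (a : tup J M) s : set (M s) :=
  range (a s).
Arguments trange {S J M} a s _.

Lemma small_trange (K : Type) (L : language) (M : structure L)
    (J : lsort L -> Type) (a : tup J M) :
  small K [set: {s & J s}] -> small_params K (trange a).
Proof.
pose f (j : {s & J s}) : {s & M s} := existT _ (projT1 j) (a _ (projT2 j)).
move=> /(small_image f); apply: small_sub => -[s m] [j _ /= <-].
by exists (existT _ s j).
Qed.

(* The partial tuple [R] is extended, one variable at a time, as long as it is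
   finitely consistent with [F]; saturation realizes the next variable once
   the finitely many variables that occur elsewhere are quantified out. *)
Lemma compactness (K : Type) (L : language) (M : structure L)
    (J : lsort L -> Type) (C : forall s, set (M s)) (F : set (set (tup J M))) :
    strong_limit K -> small K [set: nat] -> saturated K M ->
    small K [set: {s & J s}] -> small_params K C ->
    (forall X, F X -> definable C X) ->
    (forall F', finite_set F' -> F' `<=` F -> exists a, forall X, F' X -> X a) ->
  exists a, forall X, F X -> X a.
Proof.
move=> limK smN satM smJ smC defF fip.
(* The empty subfamily already provides a tuple, so every sort that has a variable is inhabited;
   [a0] supplies default values. *)
have [a0 _] : exists a : tup J M, forall X, set0 X -> X a.
  by apply: fip; [exact: finite_set0|].
pose point := {j : {s & J s} & M (projT1 j)}.
pose through (l : set point) (a : tup J M) :=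
  forall p, l p -> a _ (projT2 (projT1 p)) = projT2 p.
pose consistent (R : set point) := forall F' l, finite_set F' -> F' `<=` F ->
  finite_set l -> l `<=` R -> exists a, (\bigcap_(X in F') X) a /\ through l a.
have [Rs Rscons Rschain|R [Rcons Rmax]] := @Zorn_bigcup _ consistent.
  move=> F' l F'fin F'F lfin lR.
  have [l0|[R RsR lR']] := finite_subchain Rschain lfin lR.
    by have [a aF'] := fip _ F'fin F'F; exists a; split=> // p; rewrite l0.
  by apply: (Rscons _ RsR).
have Rfun j m m' : R (existT _ j m) -> R (existT _ j m') -> m = m'.
  move=> Rm Rm'.
  pose l : set point := [set existT _ j m; existT _ j m'].
  have lR : l `<=` R by move=> _ [->|->].
  have [a [_ al]] := Rcons set0 l (finite_set0 _) (@sub0set _ _)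
    (finite_set2 _ _) lR.
  exact: etrans (esym (al _ (or_introl erefl))) (al _ (or_intror erefl)).
(* [b0] agrees with [R] wherever [R] is defined and is arbitrary elsewhere; it turns the values of
   [R] into parameters. *)
have [b0 b0R] : exists b : tup J M, through R b.
  exists (fun s j => if pselect (exists m, R (existT _ (existT _ s j) m)) is left h
    then sval (cid h) else a0 s j) => -[[s j] m] /= Rm.
  case: pselect => [h|[]]; last by exists m.
  exact: Rfun (svalP (cid h)) Rm.
have Rtot s (j : J s) : exists m, R (existT _ (existT _ s j) m).
  apply: contrapT => /forallNP jR.
  pose C' t := C t `|` trange b0 t.
  pose ext_point F' l : set (tup (var [:: s]) M) :=
    [set e | exists a, [/\ (\bigcap_(X in F') X) a, through l a &
                           a s j = e s (var0 s [::])]].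
  have def_ext F' l : finite_set F' -> F' `<=` F -> finite_set l -> l `<=` R ->
      definable C' (ext_point F' l).
    move=> F'fin F'F lfin lR.
    have defF' := definable_bigcap F'fin (fun X F'X => defF _ (F'F _ F'X)).
    have [E0 E0fin E0P] := definable_support defF'.
    pose E := E0 `\` ([set existT _ s j] `|` (fun p : point => projT1 p) @` l).
    (* The variables of the support other than [j] and those fixed by [l] are finitely many and get
       quantified out; outside [E], every variable but [j] is replaced by its value in [b0]. *)
    have Efin : finite_set E by exact: finite_setD.
    have defZ := definable_exists_finite Efin defF'.
    pose f t (k : J t) : var [:: s] t + M t :=
      if pselect (existT _ s j = existT _ t k) is left e
      then match e in _ = x return var [:: s] (projT1 x) + M (projT1 x) with
           | erefl => inl (var0 s [::]) end
      else inr (b0 t k).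
    have fj : f s j = inl (var0 s [::]).
      by rewrite /f; case: pselect => // e; rewrite (Prop_irrelevance e erefl).
    have fnj t k : existT _ s j <> existT _ t k -> f t k = inr (b0 t k).
      by rewrite /f; case: pselect.
    have : definable C' [set e | [set a | exists2 b, (\bigcap_(X in F') X) b &
        agree_off E a b] (fun t k => pval e (f t k))].
      apply: definable_subst defZ; first by move=> t m Cm; left.
      move=> t k m; have [e|ne] := pselect (existT _ s j = existT _ t k).
        suff fx x : existT _ s j = x -> forall m', f _ (projT2 x) <> inr m'.
          by move=> /(fx _ e).
        by move=> <- m'; rewrite fj.
      by rewrite fnj // => -[<-]; right; exists k.
    congr (definable C' _); apply/seteqP; split=> e /=.
      move=> [a aF' ab]; exists a; split=> //.
      + move=> [[t k] m] lp /=; rewrite -ab; last first.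
          by move=> [_] /=; apply; right; exists (existT _ (existT _ t k) m).
        rewrite fnj /=; first exact: (b0R (existT _ (existT _ t k) m) (lR _ lp)).
        suff xR x : existT _ s j = x -> forall m', ~ R (existT _ x m').
          by move=> jk; apply: (xR _ jk); exact: lR lp.
        by move=> <-.
      + by rewrite -ab ?fj // => -[_]; apply; left.
    move=> [a [aF' al aj]].
    pose b t k :=
      if pselect (E (existT _ t k)) is left _ then a t k else pval e (f t k).
    exists b; last by move=> t k nE; rewrite /b; case: pselect.
    apply: E0P aF' => t k E0k; rewrite /b; case: pselect => // nE.
    have [jk|njk] := pselect (existT _ s j = existT _ t k).
      suff fx x : existT _ s j = x -> a _ (projT2 x) = pval e (f _ (projT2 x)).
        exact: fx jk.
      by move=> <-; rewrite fj.
    rewrite fnj //=.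
    have [[[x m] lp xk]|nl] :=
      pselect (((fun p : point => projT1 p) @` l) (existT _ t k)).
      rewrite /= in xk; subst x; have /= -> := al _ lp.
      by have /= -> := b0R _ (lR _ lp).
    by case: nE; split=> // -[/esym|].
  have [||F' F'fin F'ext|e eP] := @saturated_definable K L M C' s
      [set Y | exists F' l, [/\ finite_set F', F' `<=` F, finite_set l, l `<=` R
        & Y = ext_point F' l]] satM.
  - by apply: small_paramsU => //; exact: small_trange.
  - by move=> _ [F' [l [? ? ? ? ->]]]; exact: def_ext.
  - have [F0 [l [F0fin F0F lfin lR sub]]] : exists F0 l, [/\ finite_set F0,
        F0 `<=` F, finite_set l, l `<=` R &
        forall Y, F' Y -> ext_point F0 l `<=` Y].
      move: F' F'fin F'ext; apply: finite_set_ind => [_|Y F' _ IH YF'].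
        by exists set0, set0; split=> //; exact: finite_set0.
      have [F0 [l [F0fin F0F lfin lR sub]]] :=
        IH (fun Z F'Z => YF' _ (or_intror F'Z)).
      have [F1 [l1 [F1fin F1F l1fin l1R YE]]] := YF' Y (or_introl erefl).
      exists (F0 `|` F1), (l `|` l1); split; rewrite ?finite_setU//.
      + by move=> X [/F0F|/F1F].
      + by move=> X [/lR|/l1R].
      move=> Z [->|F'Z] e [a [aF al aj]].
        rewrite YE; exists a; split=> // [X F1X|p l1p].
          by apply: aF; right.
        by apply: al; right.
      apply: (sub _ F'Z); exists a; split=> // [X F0X|p lp].
        by apply: aF; left.
      by apply: al; left.
    have [a [aF al]] := Rcons _ _ F0fin F0F lfin lR.
    exists (ext (a s j) (@env_nil _ _)) => Y F'Y; apply: (sub _ F'Y).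
    by exists a; split.
  (* The realization [e] gives a value for [j] that keeps [R] consistent, against maximality. *)
  apply: (Rmax (R `|` [set existT _ (existT _ s j) (e s (var0 s [::]))])).
    split; first by move=> p; left.
    by move=> sub; apply: jR; apply: sub; right; reflexivity.
  move=> F' l F'fin F'F lfin lR.
  have [a [aF' al aj]] : ext_point F' (l `&` R) e.
    apply: eP; exists F', (l `&` R); split=> //.
    by apply: sub_finite_set lfin => p [].
  exists a; split=> // p lp; have [Rp|->//] := lR _ lp.
  exact: al.
exists b0 => X FX.
(* Membership in [X] depends on finitely many variables, so consistency with [R] on these puts [b0]
   in [X]. *)
have [E Efin EP] := definable_support (defF _ FX).
pose l : set point := (fun j : {s & J s} =>
  existT (fun j => M (projT1 j)) j (b0 _ (projT2 j))) @` E.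
have lR : l `<=` R.
  move=> _ [[s j] Ej <-]; have [m Rm] := Rtot s j.
  by have /= -> := b0R _ Rm.
have [|||//|a [aX al]] := Rcons [set X] l.
- exact: finite_set1.
- by move=> _ ->.
- exact: finite_image.
apply: EP (aX _ erefl) => s j Ej.
by apply: (al (existT _ (existT _ s j) (b0 s j))); exists (existT _ s j).
Qed.

(** * Type-definable sets over fixed parameters and their projections *)

Definition tdef (L : language) (M : structure L) (J : lsort L -> Type)
    (C : forall s, set (M s)) (X : set (tup J M)) : Prop :=
  exists2 F, (forall Y, F Y -> definable C Y) & X = \bigcap_(Y in F) Y.

Lemma type_definableP (K : Type) (L : language) (M : structure L)
    (J : lsort L -> Type) (X : set (tup J M)) :
  type_definable K X <->
  exists2 C : forall s, set (M s), small_params K C & tdef C X.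
Proof.
split=> [[C [Phi [smC PhiC ->]]]|[C smC [F defF ->]]].
  exists C => //; exists ((fun p => [set a | psat a p]) @` Phi).
    by move=> _ [p Phip <-]; exists p => //; exact: PhiC.
  apply/seteqP; split=> a /= h; first by move=> _ [p Phip <-]; exact: h.
  by move=> p Phip; apply: (h [set a | psat a p]); exists p.
exists C, [set p | pover C p /\ F [set a | psat a p]]; split=> //.
  by move=> p [].
apply/seteqP; split=> a /= h; first by move=> p [_ Fp]; exact: (h _ Fp).
move=> Y FY; have [p pC YE] := defF _ FY.
by rewrite YE in FY *; exact: h.
Qed.

Lemma tdef_mono (L : language) (M : structure L) (J : lsort L -> Type)
    (C C' : forall s, set (M s)) (X : set (tup J M)) :
  (forall s, C s `<=` C' s) -> tdef C X -> tdef C' X.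
Proof.
by move=> CC' [F defF ->]; exists F => // Y /defF; exact: definable_mono.
Qed.

Lemma tdef_subst (L : language) (M : structure L) (J J' : lsort L -> Type)
    (C C' : forall s, set (M s)) (f : forall s, J s -> J' s + M s)
    (X : set (tup J M)) :
    (forall s, C s `<=` C' s) -> (forall s j m, f s j = inr m -> C' s m) ->
  tdef C X -> tdef C' [set a | X (fun s j => pval a (f s j))].
Proof.
move=> CC' fC' [F defF ->].
exists ((fun Y => [set a : tup J' M | Y (fun s j => pval a (f s j))]) @` F).
  by move=> _ [Y /defF defY <-]; exact: definable_subst defY.
apply/seteqP; split=> a /= h; first by move=> _ [Y FY <-]; exact: h.
by move=> Y FY; apply: (h [set a | Y _]); exists Y.
Qed.

Lemma tdef_ren (L : language) (M : structure L) (J J' : lsort L -> Type)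
    (C : forall s, set (M s)) (r : forall s, J s -> J' s) (X : set (tup J M)) :
  tdef C X -> tdef C [set a | X (fun s j => a s (r s j))].
Proof.
move=> defX.
by apply: (tdef_subst (f := fun s j => inl (r s j)) _ _ defX) => // s.
Qed.

Lemma tdef0 (L : language) (M : structure L) (J : lsort L -> Type)
  (C : forall s, set (M s)) : tdef C (set0 : set (tup J M)).
Proof.
exists [set set0]; last by rewrite bigcap_set1.
by move=> _ ->; exact: definable_bot.
Qed.

Lemma tdef_setI (L : language) (M : structure L) (J : lsort L -> Type)
    (C : forall s, set (M s)) (X Y : set (tup J M)) :
  tdef C X -> tdef C Y -> tdef C (X `&` Y).
Proof.
move=> [F defF ->] [F' defF' ->]; exists (F `|` F'); last by rewrite bigcap_setU.
by move=> Z [/defF|/defF'].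
Qed.

Lemma tdef_setU (L : language) (M : structure L) (J : lsort L -> Type)
    (C : forall s, set (M s)) (X Y : set (tup J M)) :
  tdef C X -> tdef C Y -> tdef C (X `|` Y).
Proof.
move=> [F defF ->] [F' defF' ->].
exists [set Z | exists Z1 Z2, [/\ F Z1, F' Z2 & Z = Z1 `|` Z2]].
  by move=> _ [Z1 [Z2 [/defF d1 /defF' d2 ->]]]; exact: definable_setU.
apply/seteqP; split=> [a [h|h] _ [Z1 [Z2 [FZ1 FZ2 ->]]]|a h].
- by left; exact: h.
- by right; exact: h.
have [h1|/existsNP[Z1 /not_implyP[FZ1 nZ1]]] :=
  pselect (forall Z, F Z -> Z a); [by left; exact: h1|right=> Z2 F'Z2].
by have [|//|//] := h (Z1 `|` Z2); exists Z1, Z2.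
Qed.

(** Each set of [F] is replaced by all the definable sets over [C] that contain it. The common [C]
    keeps the parameters small however large [F] is. *)
Lemma tdef_compactness (K : Type) (L : language) (M : structure L)
    (J : lsort L -> Type) (C : forall s, set (M s)) (F : set (set (tup J M))) :
    strong_limit K -> small K [set: nat] -> saturated K M ->
    small K [set: {s & J s}] -> small_params K C ->
    (forall X, F X -> tdef C X) ->
    (forall F', finite_set F' -> F' `<=` F -> exists a, forall X, F' X -> X a) ->
  exists a, forall X, F X -> X a.
Proof.
move=> limK smN satM smJ smC defF fip.
have [|F' F'fin F'F|a aP] := @compactness K L M J C
    [set Y | definable C Y /\ exists2 X, F X & X `<=` Y] limK smN satM smJ smC.
- by move=> Y [].
- have [F0 [F0fin F0F F0F']] : exists F0, [/\ finite_set F0, F0 `<=` F &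
      forall Y, F' Y -> exists2 X, F0 X & X `<=` Y].
    move: F' F'fin F'F; apply: finite_set_ind => [_|Y F' _ IH YF'].
      by exists set0; split=> //; exact: finite_set0.
    have [F0 [F0fin F0F F0F']] := IH (fun Z F'Z => YF' _ (or_intror F'Z)).
    have [_ [X FX XY]] := YF' Y (or_introl erefl).
    exists (X |` F0); split; first by rewrite finite_setU.
      by move=> Z [->|/F0F].
    move=> Z [->|/F0F' [X' F0X' X'Z]]; first by exists X => //; left.
    by exists X' => //; right.
  have [a aP] := fip F0 F0fin F0F; exists a => Y /F0F' [X F0X]; apply.
  exact: aP.
exists a => X FX; have [F' defF' XE] := defF _ FX.
rewrite XE => Y F'Y; apply: aP; split; first exact: defF'.
by exists X => // b; rewrite XE; exact.
Qed.

Definition tjoin (S : Type) (J1 J2 M : S -> Type) (a : tup J1 M)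
    (b : tup J2 M) : tup (sumv J1 J2) M :=
  fun s j => match j with inl j => a s j | inr j => b s j end.

Lemma small_sumv (K S : Type) (J1 J2 : S -> Type) : strong_limit K ->
    small K [set: nat] -> small K [set: {s & J1 s}] ->
    small K [set: {s & J2 s}] ->
  small K [set: {s & sumv J1 J2 s}].
Proof.
move=> limK smN sm1 sm2.
pose l (j : {s & J1 s}) : {s & sumv J1 J2 s} := existT _ (projT1 j) (inl (projT2 j)).
pose r (j : {s & J2 s}) : {s & sumv J1 J2 s} := existT _ (projT1 j) (inr (projT2 j)).
apply: small_sub (small_setU limK smN (small_image l sm1) (small_image r sm2)).
by move=> [s [j|j]] _; [left|right]; exists (existT _ s j).
Qed.

(* The parameters [b0] only stand in for the variables that have been
   quantified out. *)
Lemma tdef_proj (K : Type) (L : language) (M : structure L)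
    (J1 J2 : lsort L -> Type) (C : forall s, set (M s)) (b0 : tup J2 M)
    (X : set (tup (sumv J1 J2) M)) :
    strong_limit K -> small K [set: nat] -> saturated K M ->
    small K [set: {s & J1 s}] -> small K [set: {s & J2 s}] ->
    small_params K C -> tdef C X ->
  tdef (fun s => C s `|` trange b0 s) [set a | exists b, X (tjoin a b)].
Proof.
move=> limK smN satM sm1 sm2 smC [F defF ->].
set prX := [set a | _].
(* The projection is shown to equal the intersection of its definable supersets. *)
exists [set Y | definable (fun s => C s `|` trange b0 s) Y /\ prX `<=` Y].
  by move=> Y [].
apply/seteqP; split=> a; first by move=> prXa Y [_]; exact.
move=> aP; pose at_a (Y : set (tup (sumv J1 J2) M)) := [set b | Y (tjoin a b)].
have [|_ [Y /defF defY <-]|F' F'fin F'F|b bF] :=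
    @compactness K L M J2 (fun s => C s `|` trange a s) (at_a @` F)
      limK smN satM sm2.
- by apply: small_paramsU => //; exact: small_trange.
- pose f s (j : sumv J1 J2 s) : J2 s + M s :=
    match j with inl j => inr (a s j) | inr j => inl j end.
  have : definable (fun s => C s `|` trange a s)
      [set b | Y (fun s j => pval b (f s j))].
    apply: definable_subst defY; first by move=> s m Cm; left.
    by move=> s [j|//] m [<-]; right; exists j.
  congr (definable _ _); apply/seteqP; split=> b; rewrite /at_a /=;
    by congr Y; apply: tup_ext => s [j|j].
(* Quantifying out the finitely many second variables in the support of the finite family [F0] gives
   a definable superset of the projection; as [a] lies in it, some point of the fibre over [a]
   satisfies [F0]. *)
- have [F0 [F0fin F0F ->]] := finite_subset_image F'fin F'F.
  have defF0 := definable_bigcap F0fin (fun Y F0Y => defF _ (F0F _ F0Y)).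
  have [E0 E0fin E0P] := definable_support defF0.
  pose E := E0 `&` [set j | exists k, projT2 j = inr k].
  have Efin : finite_set E by exact: finite_setIl.
  have defZ := definable_exists_finite Efin defF0.
  pose f s (j : sumv J1 J2 s) : J1 s + M s :=
    match j with inl j => inl j | inr j => inr (b0 s j) end.
  have /aP[b Xb ab] :
      [set Y | definable (fun s => C s `|` trange b0 s) Y /\ prX `<=` Y]
      [set a | exists2 b, (\bigcap_(Y in F0) Y) b & agree_off E (tjoin a b0) b].
    split.
      have : definable (fun s => C s `|` trange b0 s) [set c | [set a |
          exists2 b, (\bigcap_(Y in F0) Y) b & agree_off E a b]
          (fun s j => pval c (f s j))].
        apply: definable_subst defZ; first by move=> s m Cm; left.
        by move=> s [//|j] m [<-]; right; exists j.
      congr (definable _ _); apply/seteqP; split=> c /= [d F0d cd]; exists d => //;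
        by move=> s j nE; rewrite -cd //; case: j nE.
    move=> c [d cd].
    pose b s (j : sumv J1 J2 s) :=
      if pselect (E (existT _ s j)) is left _ then tjoin c d j else tjoin c b0 j.
    exists b; last by move=> s j nE; rewrite /b; case: pselect.
    apply: E0P (fun Y F0Y => cd Y (F0F _ F0Y)) => s j E0j.
    rewrite /b; case: pselect => // nE; case: j E0j nE => // j E0j [].
    by split=> //; exists j.
  exists (tupr b) => _ [Y F0Y <-]; rewrite /at_a /=.
  suff -> : tjoin a (tupr b) = b by exact: Xb.
  apply: tup_ext => s [j|//]; rewrite -ab //= => -[_ /= [k]] //.
by exists b => Y FY; apply: (bF (at_a Y)); exists Y.
Qed.

Lemma tdef_image (K : Type) (L : language) (M : structure L)
    (J1 J2 : lsort L -> Type) (C : forall s, set (M s)) (a0 : tup J1 M)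
    (Y : set (tup J1 M)) (R : set (tup (sumv J1 J2) M)) :
    strong_limit K -> small K [set: nat] -> saturated K M ->
    small K [set: {s & J1 s}] -> small K [set: {s & J2 s}] ->
    small_params K C -> tdef C Y -> tdef C R ->
  tdef (fun s => C s `|` trange a0 s)
    [set b | exists2 a, Y a & R (tjoin a b)].
Proof.
move=> limK smN satM sm1 sm2 smC defY defR.
have defY' := tdef_ren (fun s (j : J1 s) => inr j : sumv J2 J1 s) defY.
have defR' := tdef_ren (fun s (j : sumv J1 J2 s) =>
  match j with inl j => inr j | inr j => inl j end : sumv J2 J1 s) defR.
have := tdef_proj a0 limK smN satM sm2 sm1 smC (tdef_setI defY' defR').
congr (tdef _ _); apply/seteqP; split=> b /=.
  move=> [a [Ya Ra]]; exists a => //.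
  by move: Ra; congr R; apply: tup_ext => s [j|j].
move=> [a Ya Ra]; exists a; split=> //=.
by move: Ra; congr R; apply: tup_ext => s [j|j].
Qed.

Lemma type_definable_image (K : Type) (L : language) (M : structure L)
    (J1 J2 : lsort L -> Type) (Y : set (tup J1 M))
    (R : set (tup (sumv J1 J2) M)) :
    strong_limit K -> small K [set: nat] -> saturated K M ->
    small K [set: {s & J1 s}] -> small K [set: {s & J2 s}] ->
    type_definable K Y -> type_definable K R ->
  type_definable K [set b | exists2 a, Y a & R (tjoin a b)].
Proof.
move=> limK smN satM sm1 sm2 /type_definableP[C smC defY].
move=> /type_definableP[C' smC' defR]; apply/type_definableP.
(* A point of [Y] supplies the dummy parameters; an empty [Y] has an empty image. *)
have [Y0|/set0P[a0 Ya0]] := eqVneq Y set0.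
  exists C => //; have := @tdef0 _ M J2 C; congr (tdef _ _).
  by apply/seteqP; split=> b // [a]; rewrite Y0.
have smCC' := small_paramsU limK smN smC smC'.
exists (fun s => (C s `|` C' s) `|` trange a0 s).
  by apply: small_paramsU => //; exact: small_trange.
apply: tdef_image limK smN satM sm1 sm2 smCC' _ _.
  by apply: tdef_mono defY => s m; left.
by apply: tdef_mono defR => s m; right.
Qed.

(** * Definable subsets of hyperdefinable sets *)

Lemma act_tjoin (S : Type) (J1 J2 M : S -> Type) (f : forall s, M s -> M s)
    (a : tup J1 M) (b : tup J2 M) :
  act f (tjoin a b) = tjoin (act f a) (act f b).
Proof. by apply: tup_ext => s [j|j]. Qed.

Lemma aut_over_inv (K : Type) (L : language) (M : structure L)
    (A : set (hyperimaginary K M)) (f : forall s, M s -> M s) :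
  aut_over A f -> exists2 g, aut_over A g &
    forall (J : lsort L -> Type) (a : tup J M),
      act f (act g a) = a /\ act g (act f a) = a.
Proof.
move=> [[fbij ffun fr] fA].
have gP s : exists g : M s -> M s, cancel (f s) g /\ cancel g (f s).
  by case: (fbij s) => g; exists g.
pose g s := sval (cid (gP s)).
have fK s : cancel (f s) (g s) := proj1 (svalP (cid (gP s))).
have gK s : cancel (g s) (f s) := proj2 (svalP (cid (gP s))).
have actfK (J : lsort L -> Type) (a : tup J M) : act g (act f a) = a.
  by apply: tup_ext => s j; exact: fK.
have actgK (J : lsort L -> Type) (a : tup J M) : act f (act g a) = a.
  by apply: tup_ext => s j; exact: gK.
exists g; last by move=> J a; split.
split; first split.
- by move=> s; exists (f s).
- by move=> h a; rewrite -{1}(actgK _ a) -ffun fK.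
- by move=> r a; rewrite -{2}(actgK _ a); apply: iff_sym; exact: fr.
move=> x Ax; rewrite /fixes -{1}(fA _ Ax); apply/seteqP; split.
  by move=> _ [_ [a xa <-] <-]; rewrite actfK.
by move=> a xa; exists (act f a); [exists a|exact: actfK].
Qed.

Lemma invariant_image (K : Type) (L : language) (M : structure L)
    (A : set (hyperimaginary K M)) (J1 J2 : lsort L -> Type)
    (Y : set (tup J1 M)) (R : set (tup (sumv J1 J2) M)) :
  Defs.invariant A Y -> Defs.invariant A R ->
  Defs.invariant A [set b | exists2 a, Y a & R (tjoin a b)].
Proof.
move=> invY invR f fA b; have [g gA gK] := aut_over_inv fA.
split=> [[a Ya Rab]|[a Ya Rab]].
  exists (act g a); first by apply/(invY _ fA); rewrite (gK _ a).1.
  by apply/(invR _ fA); rewrite act_tjoin (gK _ a).1.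
exists (act f a); first exact/(invY _ fA).
by rewrite -act_tjoin; exact/(invR _ fA).
Qed.

Lemma invariant_mono (K : Type) (L : language) (M : structure L)
    (A A' : set (hyperimaginary K M)) (J : lsort L -> Type)
    (X : set (tup J M)) :
  A `<=` A' -> Defs.invariant A X -> Defs.invariant A' X.
Proof.
by move=> AA' invX f [fM fA']; apply: invX; split=> // x /AA' /fA'.
Qed.

Definition saturated_strong_limit (K : Type) (L : language) (M : structure L) :=
  [/\ strong_limit K, small K [set: nat] & saturated K M].

Lemma type_definable_over_image (K : Type) (L : language) (M : structure L)
    (A : set (hyperimaginary K M)) (J1 J2 : lsort L -> Type)
    (Y : set (tup J1 M)) (R : set (tup (sumv J1 J2) M)) :
    saturated_strong_limit K M ->
    small K [set: {s & J1 s}] -> small K [set: {s & J2 s}] ->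
    type_definable_over A Y -> type_definable_over A R ->
  type_definable_over A [set b | exists2 a, Y a & R (tjoin a b)].
Proof.
move=> [limK smN satM] sm1 sm2 [tY invY] [tR invR].
by split; [exact: type_definable_image|exact: invariant_image].
Qed.

Lemma type_definable_over_ren (K : Type) (L : language) (M : structure L)
    (A : set (hyperimaginary K M)) (J J' : lsort L -> Type)
    (r : forall s, J s -> J' s) (X : set (tup J M)) :
  type_definable_over A X ->
  type_definable_over A [set a | X (fun s j => a s (r s j))].
Proof.
move=> [/type_definableP[C smC tX] invX]; split; last first.
  by move=> f fA a; exact: invX fA (fun s j => a s (r s j)).
by apply/type_definableP; exists C => //; exact: tdef_ren.
Qed.

Lemma type_definable_over_set0 (K : Type) (L : language) (M : structure L)
    (A : set (hyperimaginary K M)) (J : lsort L -> Type) :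
  saturated_strong_limit K M -> type_definable_over A (set0 : set (tup J M)).
Proof.
move=> [limK smN satM]; split=> //; apply/type_definableP.
exists (fun=> set0); last exact: tdef0.
apply: small_le smN; suff -> : [set x : {s & M s} | set0 (projT2 x)] = set0.
  exact: card_ge0.
by apply/seteqP; split.
Qed.

Lemma type_definable_over_setI (K : Type) (L : language) (M : structure L)
    (A : set (hyperimaginary K M)) (J : lsort L -> Type)
    (X Y : set (tup J M)) :
    saturated_strong_limit K M ->
    type_definable_over A X -> type_definable_over A Y ->
  type_definable_over A (X `&` Y).
Proof.
move=> [limK smN satM] [/type_definableP[C smC tX] invX].
move=> [/type_definableP[C' smC' tY] invY]; split.
  apply/type_definableP; exists (fun s => C s `|` C' s).
    exact: small_paramsU.
  by apply: tdef_setI; [apply: tdef_mono tX|apply: tdef_mono tY] => s m; [left|right].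
by move=> f fA a; split=> -[Xa Ya]; split; [exact/(invX f fA)|exact/(invY f fA)|
  exact/(invX f fA)|exact/(invY f fA)].
Qed.

Lemma type_definable_over_setU (K : Type) (L : language) (M : structure L)
    (A : set (hyperimaginary K M)) (J : lsort L -> Type)
    (X Y : set (tup J M)) :
    saturated_strong_limit K M ->
    type_definable_over A X -> type_definable_over A Y ->
  type_definable_over A (X `|` Y).
Proof.
move=> [limK smN satM] [/type_definableP[C smC tX] invX].
move=> [/type_definableP[C' smC' tY] invY]; split.
  apply/type_definableP; exists (fun s => C s `|` C' s).
    exact: small_paramsU.
  by apply: tdef_setU; [apply: tdef_mono tX|apply: tdef_mono tY] => s m; [left|right].
by move=> f fA a; split=> -[h|h]; [left; exact/(invX f fA)|right; exact/(invY f fA)|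
  left; exact/(invX f fA)|right; exact/(invY f fA)].
Qed.

Lemma hpoint_eq (K : Type) (L : language) (M : structure L) (P : hyperdef K M)
    (x y : hpoint P) a : sval x a -> sval y a -> x = y.
Proof.
move=> xa ya; suff : sval x = sval y.
  by case: x y {xa ya} => [X hX] [Y hY] /=; exact: eq_exist.
have [b _ xE] := svalP x; have [c _ yE] := svalP y.
rewrite xE yE in xa ya *; apply/seteqP; split=> d h.
  exact: hrel_trans ya (hrel_trans (hrel_sym xa) h).
exact: hrel_trans xa (hrel_trans (hrel_sym ya) h).
Qed.

Lemma hpoint_rep (K : Type) (L : language) (M : structure L)
  (P : hyperdef K M) (x : hpoint P) : exists a, sval x a.
Proof. by have [a Pa E] := svalP x; exists a; rewrite E; exact: hrel_refl. Qed.

Lemma hpoint_class (K : Type) (L : language) (M : structure L)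
  (P : hyperdef K M) a : hset P a <-> exists x : hpoint P, sval x a.
Proof.
split=> [Pa|[x]]; last by have [b _ ->] := svalP x => /hrel_sub[].
by exists (exist _ (hrel P a) (ex_intro2 _ _ a Pa erefl)); exact: hrel_refl.
Qed.

(** On representatives this is the image of a set under a relation; classes with a common
    representative coincide, so the intermediate tuple determines the point [x]. *)
Lemma wdef1_image (K : Type) (L : language) (M : structure L)
    (A : set (hyperimaginary K M)) (P Q : hyperdef K M) (U : set (hpoint P))
    (V : hpoint P -> hpoint Q -> Prop) :
    saturated_strong_limit K M -> wdef1 A U -> wdef2 A V ->
  wdef1 A [set y | exists2 x, U x & V x y].
Proof.
move=> sM tU tV.
have := type_definable_over_image sM (@hvars_small _ _ _ P)
  (@hvars_small _ _ _ Q) tU tV.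
congr (type_definable_over A _); apply/seteqP; split=> b /=.
  move=> [a [x Ux xa] [x' [y [Vxy x'a yb]]]]; exists y => //; exists x => //.
  by rewrite (hpoint_eq xa x'a).
move=> [y [x Ux Vxy] yb]; have [a xa] := hpoint_rep x.
by exists a; [exists x|exists x, y].
Qed.

Lemma wdef1_image2 (K : Type) (L : language) (M : structure L)
    (A : set (hyperimaginary K M)) (P Q R : hyperdef K M) (U : set (hpoint P))
    (W : set (hpoint Q)) (V : hpoint P -> hpoint Q -> hpoint R -> Prop) :
    saturated_strong_limit K M -> wdef1 A U -> wdef1 A W -> wdef3 A V ->
  wdef1 A [set z | exists x y, [/\ U x, W y & V x y z]].
Proof.
move=> sM tU tW tV; have [limK smN _] := sM.
have tUW := type_definable_over_setI sM
  (type_definable_over_ren (fun s j => inl j : sumv (hvars P) (hvars Q) s) tU)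
  (type_definable_over_ren (fun s j => inr j : sumv (hvars P) (hvars Q) s) tW).
have := type_definable_over_image sM
  (small_sumv limK smN (@hvars_small _ _ _ P) (@hvars_small _ _ _ Q))
  (@hvars_small _ _ _ R) tUW tV.
congr (type_definable_over A _); apply/seteqP; split=> b /=.
  move=> [d [[x Ux xa] [y Wy ya]] [x' [y' [z [Vxyz x'a y'a zb]]]]].
  exists z => //; exists x, y; split=> //.
  by rewrite (hpoint_eq xa x'a) (hpoint_eq ya y'a).
move=> [z [x [y [Ux Wy Vxyz]]] zb].
have [a xa] := hpoint_rep x; have [a' ya'] := hpoint_rep y.
by exists (tjoin a a'); [split; [exists x|exists y]|exists x, y, z].
Qed.

Lemma wdef1_set0 (K : Type) (L : language) (M : structure L)
    (A : set (hyperimaginary K M)) (P : hyperdef K M) :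
  saturated_strong_limit K M -> wdef1 A (set0 : set (hpoint P)).
Proof.
move=> sM; have := @type_definable_over_set0 K L M A (hvars P) sM.
by congr (type_definable_over A _); apply/seteqP; split=> b // [].
Qed.

Lemma wdef1_setU (K : Type) (L : language) (M : structure L)
    (A : set (hyperimaginary K M)) (P : hyperdef K M) (U V : set (hpoint P)) :
    saturated_strong_limit K M -> wdef1 A U -> wdef1 A V ->
  wdef1 A (U `|` V).
Proof.
move=> sM tU tV; have := type_definable_over_setU sM tU tV.
congr (type_definable_over A _); apply/seteqP; split=> b /=.
  by move=> [[x Ux xb]|[x Vx xb]]; exists x => //; [left|right].
by move=> [x [Ux|Vx] xb]; [left|right]; exists x.
Qed.

Lemma wdef1_setT (K : Type) (L : language) (M : structure L)
    (A : set (hyperimaginary K M)) (P : hyperdef K M) :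
  hyperdefinable A P -> wdef1 A [set: hpoint P].
Proof.
move=> [invP _]; have : type_definable_over A (hset P).
  by split=> //; exact: hset_type_definable.
congr (type_definable_over A _); apply/seteqP; split=> b /=.
  by move=> /hpoint_class[x xb]; exists x.
by move=> [x _ xb]; apply/hpoint_class; exists x.
Qed.

Lemma wdef1_mono (K : Type) (L : language) (M : structure L)
    (A A' : set (hyperimaginary K M)) (P : hyperdef K M)
    (U : set (hpoint P)) :
  A `<=` A' -> wdef1 A U -> wdef1 A' U.
Proof. by move=> AA' [tU invU]; split=> //; exact: invariant_mono invU. Qed.

(** Type-definability uses the coordinates of a representative as parameters, while invariance holds
    because automorphisms over [A] fix the class as a set, though they may move the
    representative. *)
Lemma wdef1_point (K : Type) (L : language) (M : structure L)
    (A : set (hyperimaginary K M)) (P : hyperdef K M) (x : hpoint P) :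
  saturated_strong_limit K M -> A (existT _ P x) -> wdef1 A [set x].
Proof.
move=> [limK smN satM] Ax; suff : type_definable_over A (sval x).
  congr (type_definable_over A _); apply/seteqP; split=> b; first by exists x.
  by move=> [_ -> xb].
split; last first.
  move=> f fA a; have fx : act f @` sval x = sval x := fA.2 _ Ax.
  split=> xa; last by rewrite -fx; exists a.
  have [g _ gK] := aut_over_inv fA.
  rewrite -fx in xa; have [b xb fab] := xa.
  by rewrite -(gK _ a).2 -fab (gK _ b).2.
have [b Pb ->] := svalP x.
have /type_definableP[C smC tR] := @hrel_type_definable _ _ _ P.
apply/type_definableP; exists (fun s => C s `|` trange b s).
  by apply: small_paramsU => //; exact/small_trange/hvars_small.
pose f s (j : sumv (hvars P) (hvars P) s) : hvars P s + M s :=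
  match j with inl j => inr (b s j) | inr j => inl j end.
suff : tdef (fun s => C s `|` trange b s) [set a | [set c : tup (sumv _ _) M |
    hrel P (tupl c) (tupr c)] (fun s j => pval a (f s j))] by [].
apply: tdef_subst tR; first by move=> s m; left.
by move=> s [j|//] m [<-]; right; exists j.
Qed.

(** * Piecewise hyperdefinable groups *)

Local Open Scope group_scope.

Lemma piecewise_hyperdefinable_mono (K : Type) (L : language)
    (M : structure L) (A A' : set (hyperimaginary K M)) (T : Type)
    (P : piecewise K M T) :
  A `<=` A' -> piecewise_hyperdefinable A P -> piecewise_hyperdefinable A' P.
Proof.
move=> AA' [hP tP]; split=> [i|i j h].
  by have [h1 h2] := hP i; split; exact: invariant_mono AA' _.
by have [h1 h2] := tP i j h; split=> //; exact: invariant_mono AA' _.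
Qed.

Lemma pwdef_mono (K : Type) (L : language) (M : structure L)
    (A A' : set (hyperimaginary K M)) (T : Type) (P : piecewise K M T)
    (V : set T) :
  A `<=` A' -> pwdef A P V -> pwdef A' P V.
Proof. by move=> AA' tV i; exact: wdef1_mono AA' (tV i). Qed.

Lemma wdef_over_mono (K : Type) (L : language) (M : structure L)
    (A A' : set (hyperimaginary K M)) (T : Type) (P : piecewise K M T)
    (V : set T) :
  A `<=` A' -> wdef_over A P V -> wdef_over A' P V.
Proof. by move=> AA' [tV iV]; split=> //; exact: pwdef_mono tV. Qed.

Lemma pieceset_directed (K : Type) (L : language) (M : structure L)
    (T : Type) (P : piecewise K M T) (i j : idx P) :
  exists k, pieceset P i `|` pieceset P j `<=` pieceset P k.
Proof.
have [k ik jk] := idx_directed i j; exists k => _ [[x _ <-]|[x _ <-]].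
  by exists (trans P ik x) => //; exact: pin_trans.
by exists (trans P jk x) => //; exact: pin_trans.
Qed.

Lemma pwdef_setU (K : Type) (L : language) (M : structure L)
    (A : set (hyperimaginary K M)) (T : Type) (P : piecewise K M T)
    (U V : set T) :
    saturated_strong_limit K M -> pwdef A P U -> pwdef A P V ->
  pwdef A P (U `|` V).
Proof. by move=> sM tU tV i; exact: wdef1_setU sM (tU i) (tV i). Qed.

Lemma wdef_over_setU (K : Type) (L : language) (M : structure L)
    (A : set (hyperimaginary K M)) (T : Type) (P : piecewise K M T)
    (U V : set T) :
    saturated_strong_limit K M -> wdef_over A P U -> wdef_over A P V ->
  wdef_over A P (U `|` V).
Proof.
move=> sM [tU [i Ui]] [tV [j Vj]]; split; first exact: pwdef_setU.
have [k ijk] := pieceset_directed i j; exists k => x [/Ui|/Vj] h; apply: ijk.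
  by left.
by right.
Qed.

Lemma wdef_over_bigcup (K : Type) (L : language) (M : structure L)
    (A : set (hyperimaginary K M)) (T I : Type) (P : piecewise K M T)
    (D : set I) (F : I -> set T) :
    saturated_strong_limit K M -> finite_set D ->
    (forall i, D i -> wdef_over A P (F i)) ->
  wdef_over A P (\bigcup_(i in D) F i).
Proof.
move=> sM; move: D; apply: finite_set_ind => [_|i D _ IH tF].
  rewrite bigcup_set0; split; first by move=> i; exact: wdef1_set0.
  by have [i] := idx_nonempty P; exists i.
rewrite bigcup_setU1; apply: wdef_over_setU => //; first by apply: tF; left.
by apply: IH => j Dj; apply: tF; right.
Qed.

(** Only finitely many members leave a trace on a given piece. This is the closedness criterion
    behind all the neighbourhoods constructed below. *)
Lemma pwdef_locally_finite (K : Type) (L : language) (M : structure L)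
    (A : set (hyperimaginary K M)) (T I : Type) (P : piecewise K M T)
    (D : set I) (F : I -> set T) :
    saturated_strong_limit K M -> (forall i, D i -> wdef_over A P (F i)) ->
    (forall k, finite_set (D `&` [set i | F i `&` pieceset P k !=set0])) ->
  pwdef A P (\bigcup_(i in D) F i).
Proof.
move=> sM tF Dfin k.
have [+ _] := wdef_over_bigcup sM (Dfin k) (fun i Di => tF i Di.1).
move=> /(_ k); congr (wdef1 A _); apply/seteqP; split=> x /= [i Di Fx].
  by exists i => //; exact: Di.1.
by exists i => //; split=> //; exists (pin P k x); split=> //; exists x.
Qed.

Lemma piecewise_hyperdefinable_group_over_mono (K : Type) (L : language)
    (M : structure L) (A A' : set (hyperimaginary K M)) (G : groupType)
    (P : piecewise K M G) :
    A `<=` A' -> piecewise_hyperdefinable_group_over A P ->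
  piecewise_hyperdefinable_group_over A' P.
Proof.
move=> AA' [hP bM bV tM tV]; split=> //.
- exact: piecewise_hyperdefinable_mono hP.
- by move=> i j k; have [h1 h2] := tM i j k; split=> //; exact: invariant_mono h2.
by move=> i j; have [h1 h2] := tV i j; split=> //; exact: invariant_mono h2.
Qed.

(* The point [1] in the parameters makes every point and every piece definable
   in all pieces at once, as the product of [1] with itself. *)
Definition based_group (K : Type) (L : language) (M : structure L)
    (A : set (hyperimaginary K M)) (G : groupType) (P : piecewise K M G) :=
  piecewise_hyperdefinable_group_over A P /\
  exists i (x : hpoint (piece P i)), pin P i x = 1 /\ A (existT _ _ x).

Lemma based_group_mono (K : Type) (L : language) (M : structure L)
    (A A' : set (hyperimaginary K M)) (G : groupType) (P : piecewise K M G) :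
  A `<=` A' -> based_group A P -> based_group A' P.
Proof.
move=> AA' [/(piecewise_hyperdefinable_group_over_mono AA') hP].
by move=> [i [x [x1 Ax]]]; split=> //; exists i, x; split=> //; exact: AA'.
Qed.

Lemma exists_based_group (K : Type) (L : language) (M : structure L)
    (G : groupType) (P : piecewise K M G) :
    saturated_strong_limit K M -> piecewise_hyperdefinable_group P ->
  exists2 A : set (hyperimaginary K M), small K A & based_group A P.
Proof.
move=> [limK smN _] [A smA hP].
have [i [x x1]] := pin_surj P 1.
exists (A `|` [set existT _ _ x]).
  by apply: small_setU => //; apply: small_finite => //; exact: finite_set1.
split; last by exists i, x; split=> //; right.
by apply: piecewise_hyperdefinable_group_over_mono hP => h; left.
Qed.

Lemma wdef_over_mul_pieces (K : Type) (L : language) (M : structure L)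
    (A : set (hyperimaginary K M)) (G : groupType) (P : piecewise K M G)
    (i j : idx P) (U : set (hpoint (piece P i)))
    (V : set (hpoint (piece P j))) :
    saturated_strong_limit K M -> based_group A P -> wdef1 A U -> wdef1 A V ->
  wdef_over A P [set x * y | x in pin P i @` U & y in pin P j @` V].
Proof.
move=> sM [[hP bM _ tM _] _] tU tV; split.
  move=> k; have := wdef1_image2 sM tU tV (tM i j k).
  congr (wdef1 A _); apply/seteqP; split=> z /=.
    move=> [x [y [Ux Vy xyz]]].
    by exists (pin P i x); [exists x|exists (pin P j y); [exists y|]].
  by move=> [_ [x Ux <-] [_ [y Vy <-] xyz]]; exists x, y.
have [k ijk] := bM i j; exists k => z [_ [x _ <-] [_ [y _ <-] xyz]].
by apply: ijk; exists (pin P i x); [exists x|exists (pin P j y); [exists y|]].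
Qed.

Lemma wdef_over_pin (K : Type) (L : language) (M : structure L)
    (A : set (hyperimaginary K M)) (G : groupType) (P : piecewise K M G)
    (i : idx P) (U : set (hpoint (piece P i))) :
    saturated_strong_limit K M -> based_group A P -> wdef1 A U ->
  wdef_over A P (pin P i @` U).
Proof.
move=> sM bP tU; have [_ [j [x [x1 Ax]]]] := bP.
have := wdef_over_mul_pieces sM bP tU (wdef1_point sM Ax).
congr (wdef_over A P _); apply/seteqP; split.
  by move=> _ [y Uy [_ [_ -> <-] <-]]; rewrite x1 mulg1.
by move=> y Uy; exists y => //; exists 1; [exists x|rewrite mulg1].
Qed.

Lemma wdef_over_pieceset (K : Type) (L : language) (M : structure L)
    (A : set (hyperimaginary K M)) (G : groupType) (P : piecewise K M G)
    (i : idx P) :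
    saturated_strong_limit K M -> based_group A P ->
  wdef_over A P (pieceset P i).
Proof.
move=> sM bP; apply: wdef_over_pin => //; apply: wdef1_setT.
by have [[[]]] := bP.
Qed.

(** One hyperimaginary is chosen for each group element once and for all, so that a set of points is
    named by adjoining its image under [pt] to the parameters. *)
Lemma wdef_over_set1 (K : Type) (L : language) (M : structure L)
    (G : groupType) (P : piecewise K M G) :
    saturated_strong_limit K M ->
  exists pt : G -> hyperimaginary K M, forall g A,
    based_group A P -> A (pt g) -> wdef_over A P [set g].
Proof.
move=> sM; suff [pt ptP] : {pt : G -> hyperimaginary K M & forall g A,
    based_group A P -> A (pt g) -> wdef_over A P [set g]} by exists pt.
apply: (@choice _ _ (fun g h => forall A, based_group A P ->
  A h -> wdef_over A P [set g])) => g.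
have [i [x <-]] := pin_surj P g.
exists (existT _ _ x) => A bP Ax.
by have := wdef_over_pin sM bP (wdef1_point sM Ax); rewrite image_set1.
Qed.

Lemma pin_preimageK (K : Type) (L : language) (M : structure L) (T : Type)
    (P : piecewise K M T) (i : idx P) (U : set T) :
  U `<=` pieceset P i -> pin P i @` (pin P i @^-1` U) = U.
Proof.
move=> UP; apply/seteqP; split=> [_ [x Ux <-] //|g Ug].
by have [x _ xg] := UP _ Ug; exists x => //; rewrite /preimage /= xg.
Qed.

Lemma wdef_over_mul (K : Type) (L : language) (M : structure L)
    (A : set (hyperimaginary K M)) (G : groupType) (P : piecewise K M G)
    (U V : set G) :
    saturated_strong_limit K M -> based_group A P ->
    wdef_over A P U -> wdef_over A P V ->
  wdef_over A P [set x * y | x in U & y in V].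
Proof.
move=> sM bP [tU [i Ui]] [tV [j Vj]].
have := wdef_over_mul_pieces sM bP (tU i) (tV j).
by rewrite !pin_preimageK.
Qed.

Lemma wdef_over_inv (K : Type) (L : language) (M : structure L)
    (A : set (hyperimaginary K M)) (G : groupType) (P : piecewise K M G)
    (U : set G) :
    saturated_strong_limit K M -> based_group A P -> wdef_over A P U ->
  wdef_over A P [set x^-1 | x in U].
Proof.
move=> sM [[_ _ bV _ tV] _] [tU [i Ui]]; split.
  move=> k; have := wdef1_image sM (tU i) (tV i k).
  congr (wdef1 A _); apply/seteqP; split=> z /=.
    by move=> [x Ux xz]; exists (pin P i x).
  by move=> [y Uy yz]; have [x _ xy] := Ui _ Uy; exists x; rewrite xy.
have [k ik] := bV i; exists k => _ [x Ux <-]; apply: ik.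
by exists x => //; exact: Ui.
Qed.

Lemma wdef_over_setpow (K : Type) (L : language) (M : structure L)
    (A : set (hyperimaginary K M)) (G : groupType) (P : piecewise K M G)
    (V : set G) (n : nat) :
    saturated_strong_limit K M -> based_group A P -> wdef_over A P V ->
  wdef_over A P (setpow V n).
Proof.
move=> sM bP tV; elim: n => [|n IH] /=; last exact: wdef_over_mul.
have [_ [i [x [<- Ax]]]] := bP.
by have := wdef_over_pin sM bP (wdef1_point sM Ax); rewrite image_set1.
Qed.

Lemma wdef_over_translate (K : Type) (L : language) (M : structure L)
    (A : set (hyperimaginary K M)) (G : groupType) (P : piecewise K M G)
    (g : G) (V : set G) :
    saturated_strong_limit K M -> based_group A P ->
    wdef_over A P [set g] -> wdef_over A P V ->
  wdef_over A P [set g * y | y in V].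
Proof.
move=> sM bP tg tV; have := wdef_over_mul sM bP tg tV.
congr (wdef_over A P _); apply/seteqP; split.
  by move=> _ [_ -> [y Vy <-]]; exists y.
by move=> _ [y Vy <-]; exists g => //; exists y.
Qed.

(** * Maximal separated sets and the locally finite cover *)

Definition separated (G : groupType) (V D : set G) :=
  forall g h v w, D g -> D h -> V v -> V w -> g * v = h * w -> g = h.

Lemma exists_maximal_separated (G : groupType) (V : set G) : V 1 ->
  exists2 D, separated V D &
    forall x, exists g v w, [/\ D g, V v, V w & g * v = x * w].
Proof.
move=> V1; have [F Fsep Ftot|D [Dsep Dmax]] := @Zorn_bigcup _ (separated V).
  move=> g h v w [X FX Xg] [Y FY Yh] Vv Vw.
  have [XY|YX] := Ftot _ _ FX FY.
    by apply: (Fsep _ FY) => //; exact: XY.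
  by apply: (Fsep _ FX) => //; exact: YX.
exists D => // x; apply: contrapT => xN.
have xD g v w : D g -> V v -> V w -> g * v = x * w -> False.
  by move=> Dg Vv Vw e; apply: xN; exists g, v, w.
apply: (Dmax (D `|` [set x])).
  split; first by move=> g; left.
  by move=> sub; apply: (xD x 1 1) => //; apply: sub; right.
move=> g h v w [Dg|->] [Dh|->] Vv Vw e //.
- exact: Dsep Vv Vw e.
- by have := xD _ _ _ Dg Vv Vw e.
- by have := xD _ _ _ Dh Vw Vv (esym e).
Qed.

(** By symmetry of [V], a point [g] of [D] in the translate [e V] has [e] in [g V]; two such points
    have translates meeting at [e], hence coincide. *)
Lemma separated_finite_translates (G : groupType) (V D E : set G) :
    separated V D -> V = [set x^-1 | x in V] -> finite_set E ->
  finite_set (D `&` [set x * y | x in E & y in V]).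
Proof.
move=> Dsep Vsym Efin.
apply: (@sub_finite_set _ _ (\bigcup_(e in E)
    (D `&` [set e * y | y in V]))).
  by move=> g [Dg [e Ee [y Vy eyg]]]; exists e => //; split=> //; exists y.
apply: bigcup_finite => // e _.
have [->|/set0P[g [Dg [y Vy yg]]]] := eqVneq (D `&` [set e * y | y in V]) set0.
  exact: finite_set0.
apply: sub_finite_set (finite_set1 g) => h [Dh [z Vz zh]].
have Vinv x : V x -> V x^-1 by move=> Vx; rewrite Vsym; exists x.
apply: Dsep Dh Dg (Vinv _ Vz) (Vinv _ Vy) _.
by rewrite -zh -yg !mulgK.
Qed.

Lemma exists_locally_finite_cover (K : Type) (L : language) (M : structure L)
    (G : groupType) (P : piecewise K M G) (V : set G) :
    saturated_strong_limit K M -> piecewise_hyperdefinable_group P ->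
    generic P V -> symmetric_set V ->
  let VV := [set x * y | x in V & y in V] in
  exists A, [/\ small K A, based_group A P, wdef_over A P V & exists D, [/\
    (forall g, D g -> wdef_over A P [set g * y | y in VV]),
    (forall x, exists2 g, D g & [set g * y | y in VV] x) &
    (forall W, wdef P W ->
      finite_set (D `&` [set g | [set g * y | y in VV] `&` W !=set0]))]].
Proof.
move=> sM hP [[AV smAV tV] Vgen] [V1 Vsym] VV.
have [limK smN _] := sM.
have [AG smAG bP] := exists_based_group sM hP.
have Vinv x : V x -> V x^-1 by move=> Vx; rewrite Vsym; exists x.
pose A0 := AG `|` AV.
have smA0 : small K A0 by exact: small_setU.
have bP0 : based_group A0 P by apply: based_group_mono bP => h; left.
have tV0 : wdef_over A0 P V by apply: wdef_over_mono tV => h; right.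
have [D Dsep Dmax] := exists_maximal_separated V1.
have Dfin W : wdef P W ->
    finite_set (D `&` [set g | [set g * y | y in VV] `&` W !=set0]).
  move=> [AW smAW tW].
  pose A1 := A0 `|` AW.
  have bP1 : based_group A1 P by apply: based_group_mono bP0 => h; left.
  have tV1 : wdef_over A1 P V by apply: wdef_over_mono tV0 => h; left.
  have tW1 : wdef_over A1 P W by apply: wdef_over_mono tW => h; right.
  (* If [g VV] meets [W], then [g] lies in [W VV], as [VV] is closed under inverses; genericity is
     applied to this larger set. The parameters of [W] serve here only and do not enter the final
     [A]. *)
  have [|E Efin WE] := Vgen [set x * y | x in W & y in VV].
    exists A1; first exact: small_setU.
    by do 2! apply: wdef_over_mul => //.
  apply: sub_finite_set (separated_finite_translates Dsep Vsym Efin).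
  move=> g [Dg [_ [[_ [x Vx [y Vy <-]] <-] Wgxy]]]; split=> //; apply: WE.
  exists (g * (x * y)) => //; exists (y^-1 * x^-1).
    by exists y^-1; [exact: Vinv|exists x^-1 => //; exact: Vinv].
  by rewrite !mulgA !mulgK.
have [pt ptP] := wdef_over_set1 P sM.
have smD : small K D.
  (* Every point of [D] lies in a piece of the cofinal family, and [g] belongs to [g VV]; hence [D]
     is a small union of finite sets. *)
  have [C smC Ccof] := idx_cofinality P.
  apply: small_sub (small_bigcup_finite limK smN smC
    (fun i _ => Dfin (pieceset P i) _)).
    move=> g Dg; have [i [x xg]] := pin_surj P g.
    have [j Cj ij] := Ccof i; exists j => //; split=> //; exists g; split.
      by exists 1; [exists 1 => //; exists 1 => //|]; rewrite !mulg1.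
    by exists (trans P ij x) => //; rewrite pin_trans.
  by exists A0 => //; exact: wdef_over_pieceset.
(* Only with [D] known to be small can its points be named. *)
pose A := A0 `|` pt @` D.
have A0A : A0 `<=` A by move=> h; left.
have bPA : based_group A P by exact: based_group_mono bP0.
have tVA : wdef_over A P V by exact: wdef_over_mono tV0.
exists A; split=> //.
  by apply: small_setU => //; exact: small_image.
exists D; split=> //.
- move=> g Dg; apply: wdef_over_translate => //; last exact: wdef_over_mul.
  by apply: ptP => //; right; exists g.
- move=> x; have [g [v [w [Dg Vv Vw gvxw]]]] := Dmax x; exists g => //.
  exists (v * w^-1); first by exists v => //; exists w^-1 => //; exact: Vinv.
  by rewrite mulgA gvxw mulgK.
Qed.

Lemma generic_setpow_nbhd (K : Type) (L : language) (M : structure L)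
    (G : groupType) (P : piecewise K M G) (V : set G) (n : nat) :
    saturated_strong_limit K M -> piecewise_hyperdefinable_group P ->
    generic P V -> symmetric_set V ->
  exists A : set (hyperimaginary K M), [/\ small K A,
    piecewise_hyperdefinable A P & logic_nbhd A P (setpow V n) (setpow V n.+2)].
Proof.
move=> sM hP genV symV; have [limK smN _] := sM.
have [A [smA bP tV [D [tD Dcov Dfin]]]] :=
  exists_locally_finite_cover sM hP genV symV.
have [[_ Vgen] [V1 Vsym]] := (genV, symV).
have Vinv x : V x -> V x^-1 by move=> Vx; rewrite Vsym; exists x.
set VV := [set x * y | x in V & y in V] in tD Dcov Dfin.
have [|E Efin WE] := Vgen (setpow V n.+4).
  by exists A => //; exact: wdef_over_setpow.
have [pt ptP] := wdef_over_set1 P sM.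
(* The second cover consists of translates by the points of [E], which need names as well. *)
pose B := A `|` pt @` E.
have AB : A `<=` B by move=> h; left.
have bPB : based_group B P by exact: based_group_mono bP.
exists B; split.
- apply: small_setU => //; apply: small_finite => //; exact: finite_image.
- by have [[]] := bPB.
pose far := [set U | U `&` setpow V n = set0].
pose F1 := \bigcup_(g in D `&` [set g | far [set g * y | y in VV]])
  [set g * y | y in VV].
pose F2 := \bigcup_(g in E `&` [set g | far [set g * y | y in V]])
  [set g * y | y in V].
exists (~` (F1 `|` F2)); last split.
- rewrite /logic_open setCK; apply: pwdef_setU => //.
    apply: pwdef_mono AB _; apply: pwdef_locally_finite => //.
      by move=> g [Dg _]; exact: tD.
    move=> k; apply: sub_finite_set (Dfin (pieceset P k) _).
      by move=> g [[Dg _] h].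
    by exists A => //; exact: wdef_over_pieceset.
  apply: (proj1 (wdef_over_bigcup _ _ _)) => //; first exact: finite_setIl.
  move=> g [Eg _]; apply: wdef_over_translate => //; last exact: wdef_over_mono tV.
  by apply: ptP => //; right; exists g.
- move=> x Vx [[g [_ far_g] gx]|[g [_ far_g] gx]];
    by have : set0 x by rewrite -far_g.
move=> x xF.
have xWE : setpow V n.+4 x.
  have [g Dg gx] := Dcov x.
  have /set0P[_ [[_ [v1 Vv1 [v2 Vv2 <-]] <-] Vu]] :
      [set g * y | y in VV] `&` setpow V n != set0.
    by apply/eqP => far_g; apply: xF; left; exists g.
  have [_ [v3 Vv3 [v4 Vv4 <-]] <-] := gx.
  (* The product [g v1 v2] lies in [V^n], and four further factors from [V] lead to [g v3 v4]. *)
  have -> : g * (v3 * v4) = g * (v1 * v2) * v2^-1 * v1^-1 * v3 * v4.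
    by rewrite !mulgA !mulgK.
  have step m u v : setpow V m u -> V v -> setpow V m.+1 (u * v).
    by move=> Vu' Vv; exists u => //; exists v.
  by do 4! [apply: (step) => //; try exact: Vinv].
have [g Eg [v Vv gvx]] := WE _ xWE.
have /set0P[_ [[w Vw <-] Vu]] : [set g * y | y in V] `&` setpow V n != set0.
  by apply/eqP => far_g; apply: xF; right; exists g => //; exists v.
(* Since [g w] lies in [V^n], writing [x = g v] as [(g w) w^-1 v] uses only two further factors. *)
exists (g * w * w^-1); first by exists (g * w) => //; exists w^-1 => //; exact: Vinv.
by exists v; rewrite // mulgK.
Qed.

(** * Generic pieces and local hyperdefinability *)

Lemma generic_piece_locally_hyperdefinable (K : Type) (L : language)
    (M : structure L) (G : groupType) (P : piecewise K M G) :
    saturated_strong_limit K M -> piecewise_hyperdefinable_group P ->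
  has_generic_piece P -> locally_hyperdefinable P.
Proof.
move=> sM hP [i [_ Pgen]]; have [limK smN _] := sM.
have [A0 smA0 bP0] := exists_based_group sM hP.
(* A piece need not be symmetric: it is enlarged by its inverses and by [1], written as a power of
   exponent 0. *)
pose V := (pieceset P i `|` [set x^-1 | x in pieceset P i]) `|`
  setpow (pieceset P i) 0.
have symV : symmetric_set V.
  split; first by right.
  have sub : V `<=` [set x^-1 | x in V].
    move=> x [[Px|[y Py <-]]|->].
    - by exists x^-1; [left; right; exists x|rewrite invgK].
    - by exists y => //; left; left.
    - by exists 1; [right|rewrite invg1].
  apply/seteqP; split=> // _ [x Vx <-].
  by have [y Vy <-] := sub _ Vx; rewrite invgK.
have genV : generic P V.
  split.
    have tP := wdef_over_pieceset i sM bP0.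
    exists A0 => //; apply: wdef_over_setU => //; last exact: wdef_over_setpow.
    by apply: wdef_over_setU => //; exact: wdef_over_inv.
  move=> W /Pgen[D Dfin WD]; exists D => // w /WD[g Dg [x Px gxw]].
  by exists g => //; exists x => //; left; left.
have [A [smA bP tV [D [tD Dcov Dfin]]]] :=
  exists_locally_finite_cover sM hP genV symV.
exists A => //; split; first by have [[]] := bP.
move=> x; pose VV := [set x * y | x in V & y in V].
pose near := [set g | [set g * y | y in VV] x].
have [pt ptP] := wdef_over_set1 P sM.
(* Naming [x] only serves to show that finitely many translates contain it; the name stays out of
   [A], so the same parameters work at every point. *)
have Dx : finite_set (D `&` near).
  apply: sub_finite_set (Dfin [set x] _).
    by move=> g [Dg gx]; split=> //; exists x.
  exists (A `|` [set pt x]).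
    by apply: small_setU => //; apply: small_finite => //; exact: finite_set1.
  apply: ptP; last by right.
  by apply: based_group_mono bP => z; left.
exists (\bigcup_(g in D `&` near) [set g * y | y in VV]).
  by apply: wdef_over_bigcup => // g [Dg _]; exact: tD.
(* Removing the translates that miss [x] leaves an open set containing [x], which the cover places
   inside the union of those that contain [x]. *)
exists (~` \bigcup_(g in D `&` ~` near) [set g * y | y in VV]).
  rewrite /logic_open setCK; apply: pwdef_locally_finite => //.
    by move=> g [Dg _]; exact: tD.
  move=> k; apply: sub_finite_set (Dfin (pieceset P k) _).
    by move=> g [[Dg _] ?].
  by exists A => //; exact: wdef_over_pieceset.
split; first by move=> _ -> [g [_ gx]] /gx.
move=> y yN; have [g Dg gy] := Dcov y; exists g => //; split=> //.
by apply: contrapT => gx; apply: yN; exists g.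
Qed.

(* The neighbourhood of [1] is translated only by points of the set [W] to be
   covered: this keeps all the parameters in one small set even when the
   cardinal [K] is singular. *)
Lemma small_locally_hyperdefinable_generic_piece (K : Type) (L : language)
    (M : structure L) (G : groupType) (P : piecewise K M G) :
    saturated_strong_limit K M -> piecewise_hyperdefinable_group P ->
    small K [set: G] -> locally_hyperdefinable P ->
  has_generic_piece P.
Proof.
move=> sM hP smG [A smA [_ /(_ 1)[U [tU [i Ui]] [O oO [O1 OU]]]]].
have [limK smN satM] := sM.
have {}O1 : O 1 by exact: O1.
have [A0 smA0 bP0] := exists_based_group sM hP.
exists i; split; first by exists A0 => //; exact: wdef_over_pieceset.
move=> W [AW smAW [tW [j Wj]]].
apply: contrapT => /forall2NP noD.
have W0 : exists w, W w.
  apply: contrapT => W0; have [[]|[]] := noD set0; first exact: finite_set0.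
  by move=> w Ww; case: W0; exists w.
have [[_ bM bV tM _] _] := bP0.
(* The piece [k] contains all quotients [g^-1 w] of points of [W]; on it the complement of [O] is
   type-definable. *)
have [j' jj'] := bV j; have [k jk] := bM j' j.
have /type_definableP[CW smCW tCW] := (tW j).1.
have /type_definableP[CF smCF tCF] := (oO k).1.
have /type_definableP[CM smCM tCM] := (tM j k j).1.
have [b1 Pb1] := hset_nonempty (piece P j).
have [b bP] : {b : G -> tup (hvars (piece P j)) M & forall g, W g ->
    exists2 x, pin P j x = g & sval x (b g)}.
  apply: (@choice _ _ (fun g (b : tup (hvars (piece P j)) M) => W g ->
    exists2 x, pin P j x = g & sval x b)) => g.
  have [Wg|nWg] := pselect (W g); last by exists b1.
  have [x _ xg] := Wj _ Wg; have [a xa] := hpoint_rep x.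
  by exists a => _; exists x.
have [a0 Pa0] := hset_nonempty (piece P k).
(* As [G] is small, the representatives [b g] together contribute a small parameter set, over which
   every translate by a point of [W] can be expressed. *)
pose CB s := \bigcup_(g in [set: G]) trange (b g) s.
pose C s := ((CW s `|` CF s) `|` CM s) `|` CB s.
have smCB : small_params K CB.
  have := small_setX limK smG (@hvars_small _ _ _ (piece P j)).
  pose f (p : G * {s & hvars (piece P j) s}) : {s & M s} :=
    existT _ (projT1 p.2) (b p.1 _ (projT2 p.2)).
  move=> /(small_image f); apply: small_sub => -[s m] [g _ [v _ /= vm]].
  by exists (g, existT _ s v) => //; rewrite /f /= vm.
have smC : small_params K C by do 3! apply: small_paramsU => //.
pose prod g (a : tup (hvars (piece P k)) M) (c : tup (hvars (piece P j)) M) :=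
  exists x y z, [/\ pin P j x * pin P k y = pin P j z,
    sval x (b g), sval y a & sval z c].
pose Wset := [set c | exists2 x, (pin P j @^-1` W) x & sval x c].
pose Fset := [set a | exists2 y, (pin P k @^-1` (~` O)) y & sval y a].
(* For [g] in [W], this represents the points of [W] outside [g O]. Since [O] lies in piece [i], a
   point of [W] outside finitely many translates of that piece belongs to the corresponding sets. *)
pose Y g := Wset `&` [set c | exists2 a, Fset a & prod g a c].
have tY g : tdef (fun s => C s `|` trange a0 s) (Y g).
  apply: tdef_setI.
    by apply: tdef_mono tCW => s m ?; left; left; left; left.
  have tCF' : tdef C Fset by apply: tdef_mono tCF => s m ?; left; left; right.
  pose f s (v : sumv (sumv (hvars (piece P j)) (hvars (piece P k)))
      (hvars (piece P j)) s) :
      sumv (hvars (piece P k)) (hvars (piece P j)) s + M s :=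
    match v with
    | inl (inl v) => inr (b g s v)
    | inl (inr v) => inl (inl v)
    | inr v => inl (inr v)
    end.
  have tR := tdef_subst (C' := C) (f := f) _ _ tCM.
  apply: tdef_image limK smN satM _ _ smC tCF' (tR _ _); try exact: hvars_small.
    by move=> s m ?; left; right.
  by move=> s [[v|v]|v] m //= [<-]; right; exists g => //; exists v.
have [c cY] : exists c, forall X, (Y @` W) X -> X c.
  apply: (@tdef_compactness K L M _ (fun s => C s `|` trange a0 s)) => //.
  - exact: hvars_small.
  - by apply: small_paramsU => //; exact/small_trange/hvars_small.
  - by move=> _ [g _ <-]; exact: tY.
  move=> F' F'fin F'W; have [D [Dfin DW ->]] := finite_subset_image F'fin F'W.
  have [[]//|/existsNP[w /not_implyP[Ww wD]]] := noD D.
  have [z _ zw] := Wj _ Ww; have [c zc] := hpoint_rep z.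
  exists c => _ [g Dg <-]; split; first by exists z => //; rewrite /preimage /= zw.
  have Wg := DW _ Dg; have [x xg xb] := bP _ Wg.
  have [y _ yE] : pieceset P k (g^-1 * w).
    apply: jk; exists g^-1; last by exists w => //; exact: Wj.
    by apply: jj'; exists g => //; exact: Wj.
  have [a ya] := hpoint_rep y; exists a.
    exists y => //= Oy; apply: wD; exists g => //; exists (pin P k y).
      by apply: Ui; exact: OU.
    by rewrite yE mulgA mulgV mul1g.
  by exists x, y, z; split=> //; rewrite xg yE zw mulgA mulgV mul1g.
(* The common point [z] of these sets lies in [W], so [g] may be [z] itself: [z] is then outside
   [z O], which puts [1] outside [O]. *)
have [w Ww] := W0; have [[z Wz zc] _] := cY _ (ex_intro2 _ _ w Ww erefl).
have [_ [a [y nOy ya] [x' [y' [z' [xyz x'b y'a z'c]]]]]] :=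
  cY _ (ex_intro2 _ _ (pin P j z) Wz erefl).
have [x xz xb] := bP _ Wz.
rewrite -(hpoint_eq xb x'b) -(hpoint_eq ya y'a) -(hpoint_eq zc z'c) xz in xyz.
apply: nOy; suff -> : pin P k y = 1 by [].
by apply: (mulgI (pin P j z)); rewrite xyz mulg1.
Qed.

(** Even a language without symbols has infinitely many formulas: nested implications between copies
    of [fbot], told apart by their depth. *)
Lemma small_nat (K : Type) (L : language) :
  small K [set: {C : seq (lsort L) & formula C}] -> small K [set: nat].
Proof.
pose phi n : {C : seq (lsort L) & formula C} :=
  existT _ [::] (iter n (fimp (fbot [::])) (fbot [::])).
pose depth := fix depth (C : seq (lsort L)) (p : formula C) : nat :=
  if p is fimp _ q then (depth C q).+1 else 0.
have phiK : cancel phi (fun p => depth _ (projT2 p)).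
  by elim=> [//|n IH] /=; congr S.
apply: small_le; apply: (card_le_rel (R := fun n p => p = phi n)).
  by move=> n _; exists (phi n).
by move=> m n p _ _ -> /(can_inj phiK).
Qed.

Theorem theorem2p21 (L : language) (M : structure L) (K : Type)
    (K_gt_L : small K [set: {C : seq (lsort L) & formula C}])
    (K_strong_limit : strong_limit K)
    (M_saturated : saturated K M)
    (M_homogeneous : strongly_homogeneous K M)
    (G : groupType) (P : piecewise K M G)
    (G_group : piecewise_hyperdefinable_group P) :
  [/\ forall V : set G, generic P V -> symmetric_set V ->
        forall n : nat, exists A : set (hyperimaginary K M),
          [/\ small K A, piecewise_hyperdefinable A P
            & logic_nbhd A P (setpow V n) (setpow V n.+2)],
      has_generic_piece P -> locally_hyperdefinable P
    & small K [set: G] -> (locally_hyperdefinable P <-> has_generic_piece P)].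
Proof.
have sM : saturated_strong_limit K M by split=> //; exact: small_nat K_gt_L.
split=> [V genV symV n||smG]; first exact: generic_setpow_nbhd.
  exact: generic_piece_locally_hyperdefinable.
split; first exact: small_locally_hyperdefinable_generic_piece.
exact: generic_piece_locally_hyperdefinable.
Qed.
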